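(* Let $D$ be an associative unital $k$-algebra, $R=A_3$, $V=\mathbf M(\{1\},\{2,3,4\},D)$ and $L=\mathrm{TKK}(V)$, with its $A_3$-grading. Let $\gamma\in\mathrm{supp}_{\mathcal Q(R)}\mathfrak{uce}(L)\setminus R$. (i) The element $\gamma$ is a degenerate sum $\gamma=\alpha+\beta$ (so $\alpha$ and $\beta$ are non-zero distinct roots whose sum is not a root). (ii) For every degenerate sum $\gamma=\alpha+\beta$ there is a $k$-module isomorphism $\mathfrak{uce}(L)_\gamma\cong D_2$ given by $[x_\alpha(a),x_\beta(b)]\mapsto\overline{ab}$ ($a,b\in D$).
   Context: $k$ is an arbitrary commutative associative unital ring. $A_3=\{\varepsilon_i-\varepsilon_j:1\le i,j\le4\}$ (including $0$), with root lattice $\mathcal Q(A_3)$. The degenerate sums of $A_3$ (sums $\alpha+\beta$ of two linearly independent roots such that all integers $\langle\alpha+\beta,\delta^\vee\rangle$, $\delta\in A_3$, have a common divisor $>1$) are the six elements $\pm(\varepsilon_1-\varepsilon_2+\varepsilon_3-\varepsilon_4)$, $\pm(\varepsilon_1-\varepsilon_2-\varepsilon_3+\varepsilon_4)$, $\pm(\varepsilon_1+\varepsilon_2-\varepsilon_3-\varepsilon_4)$. $V=(V^+,V^-)=(\mathrm{Mat}(1,J,D),\mathrm{Mat}(J,1,D))$, $J=\{2,3,4\}$, is the Jordan pair with $Q_x(y)=xyx$ and triple products $\{x\,y\,z\}=xyz+zyx$. Put $\delta(x,y)\in\mathrm{End}(V^+)\times\mathrm{End}(V^-)$, $\delta(x,y)=(z\mapsto\{x\,y\,z\},\;w\mapsto-\{y\,x\,w\})$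 for $x\in V^+$, $y\in V^-$, and let $\mathfrak{ider}(V)$ be the span of all $\delta(x,y)$. $\mathrm{TKK}(V)=V^+\oplus\mathfrak{ider}(V)\oplus V^-$ is the Lie algebra with $[V^\pm,V^\pm]=0$, $[x,y]=\delta(x,y)$ for $x\in V^+,y\in V^-$, $[T,v]=T(v)$ for $T\in\mathfrak{ider}(V)$, $v\in V^\pm$, and the commutator on $\mathfrak{ider}(V)$. For $i,j\in J$ let $E_{1i}(a)\in V^+$ and $E_{j1}(a)\in V^-$ be the elementary matrices with entry $a$, and for $i\ne j$ put $E_{ji}(a)=-\delta(E_{1i}(a),E_{j1}(1))$. Then $L=\mathrm{TKK}(V)$ is $\mathcal Q(A_3)$-graded with $L_{\varepsilon_i-\varepsilon_j}=E_{ij}(D)$ for $1\le i\ne j\le4$ and $L_0=\sum_{j\in J}[E_{1j}(D),E_{j1}(D)]$. For a Lie algebra $L$: $\mathfrak{uce}(L)=(L\wedge L)/\mathcal B$, $\mathcal B$ spanned by $x\wedge[y,z]+y\wedge[z,x]+z\wedge[x,y]$; $\langle x,y\rangle$ is the class of $x\wedge y$; $u(\langle x,y\rangle)=[x,y]$; the bracket is $[X,Y]=\langle u(X),u(Y)\rangle$; if $L$ is graded, then $\mathfrak{uce}(L)_\gamma=\sum_\delta\langle L_\delta,L_{\gamma-\delta}\rangle$. In the present situation $u$ restricts to a bijection $\mathfrak{uce}(L)_\alpha\to L_\alpha$ for every non-zero root $\alpha$, and for $\alpha=\varepsilon_i-\varepsilon_j$, $x_\alpha(a)\in\mathfrak{uce}(L)_\alpha$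 denotes the unique element with $u(x_\alpha(a))=E_{ij}(a)$. $\mathrm{supp}$ denotes the set of degrees with non-zero component. $D_2$ is the quotient of $D$ by the two-sided ideal generated by $2D$ and $[D,D]$; $\bar a$ is the class of $a\in D$. *)

(* Defs.v *)
From HB Require Import structures.
From mathcomp Require Import all_boot all_order all_algebra.
From mathcomp Require Import generic_quotient ring_quotient.
From mathcomp Require Import finmap boolp classical_sets functions cardinality fsbigop.

Set Implicit Arguments.
Unset Strict Implicit.
Unset Printing Implicit Defensive.

Import GRing.Theory.
Local Open Scope classical_set_scope.
Local Open Scope ring_scope.
Local Open Scope quotient_scope.

Section Span.
Variables (k : pzRingType) (M : lmodType k) (S : set M).

Definition kspan : set M :=
  [set x | exists n (c : 'I_n -> k) (v : 'I_n -> M),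
     (forall i, S (v i)) /\ x = \sum_i c i *: v i].

Lemma kspan0 : kspan 0.
Proof. by exists 0, (fun=> 0), (fun=> 0); split; [case | rewrite big_ord0]. Qed.

Lemma kspan_incl x : S x -> kspan x.
Proof.
move=> Sx; exists 1, (fun=> 1), (fun=> x); split=> //.
by rewrite big_ord1 scale1r.
Qed.

Lemma kspanD x y : kspan x -> kspan y -> kspan (x + y).
Proof.
move=> [n [c [v [Sv ->]]]] [m [d [w [Sw ->]]]].
exists (n + m)%N, (fun i : 'I_(n + m) => match fintype.split i with inl a => c a | inr b => d b end),
  (fun i : 'I_(n + m) => match fintype.split i with inl a => v a | inr b => w b end); split.
  by move=> i; case: (fintype.split i).
rewrite big_split_ord /=; congr (_ + _); apply: eq_bigr => i _.
  by rewrite (unsplitK (inl i)).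
by rewrite (unsplitK (inr i)).
Qed.

Lemma kspanZ a x : kspan x -> kspan (a *: x).
Proof.
move=> [n [c [v [Sv ->]]]]; exists n, (fun i => a * c i), v; split=> //.
by rewrite scaler_sumr; apply: eq_bigr => i _; rewrite scalerA.
Qed.

Lemma kspan_ind (P : M -> Prop) : P 0 -> (forall x y, P x -> P y -> P (x + y)) ->
  (forall a x, P x -> P (a *: x)) -> (forall x, S x -> P x) ->
  forall x, kspan x -> P x.
Proof.
move=> P0 PD PZ PS x [n [c [v [Sv ->]]]].
by apply: (big_ind P) => // i _; apply/PZ/PS.
Qed.

Lemma kspan_ind_lin (P : M -> Prop) : P 0 ->
  (forall a x y, P x -> P y -> P (a *: x + y)) -> (forall x, S x -> P x) ->
  forall x, kspan x -> P x.
Proof.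
move=> P0 PL PS x; elim/kspan_ind => // [y z Py Pz|a y Py].
  by rewrite -[y]scale1r; apply: PL.
by rewrite -[_ *: _]addr0; apply: PL.
Qed.

Definition inspan : {pred M} := fun x => `[< kspan x >].

Lemma inspanP x : reflect (kspan x) (x \in inspan).
Proof. exact: asboolP. Qed.

Lemma inspan_submod_closed : submod_closed inspan.
Proof.
split; first exact/inspanP/kspan0.
by move=> a x y /inspanP xS /inspanP yS; apply/inspanP/kspanD => //; apply: kspanZ.
Qed.

HB.instance Definition _ := GRing.isSubmodClosed.Build k M inspan inspan_submod_closed.

Record spanmod := SpanMod { spanval : M; _ : inspan spanval }.

HB.instance Definition _ := [isSub for spanval].
HB.instance Definition _ := [Choice of spanmod by <:].
HB.instance Definition _ :=
  GRing.SubChoice_isSubLmodule.Build k M inspan spanmod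
    (GRing.submod_closed_semi inspan_submod_closed).

Definition inSpan x (Sx : kspan x) : spanmod := SpanMod (introT (inspanP x) Sx).

(* M / kspan S *)
Definition quotspan := Quotient.quot [the zmodClosed M of inspan].

HB.instance Definition _ := GRing.Zmodule.on quotspan.
HB.instance Definition _ := Quotient.on quotspan.

Definition qpi (x : M) : quotspan := \pi_quotspan x.

Lemma qpiE x y : qpi x = qpi y <-> kspan (x - y).
Proof.
split=> [/eqP|xy]; last apply/eqP; rewrite -(Quotient.idealrBE [the zmodClosed M of inspan]).
  by move/inspanP.
exact/inspanP.
Qed.

Lemma qpi_repr q : qpi (repr q) = q.
Proof. exact: reprK. Qed.

Lemma qpiD x y : qpi (x + y) = qpi x + qpi y.
Proof. exact: (raddfD (\pi_(Quotient.quot [the zmodClosed M of inspan]))). Qed.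

Definition qscale (a : k) (q : quotspan) : quotspan := qpi (a *: repr q).

Lemma qscale_pi a x : qscale a (qpi x) = qpi (a *: x).
Proof. by apply/qpiE; rewrite -scalerBr; apply/kspanZ/qpiE; rewrite qpi_repr. Qed.

Lemma qscaleA a b q : qscale a (qscale b q) = qscale (a * b) q.
Proof. by rewrite -[q]qpi_repr !qscale_pi scalerA. Qed.
Lemma qscale1 : left_id 1 qscale.
Proof. by move=> q; rewrite -[q]qpi_repr qscale_pi scale1r. Qed.
Lemma qscaleDr : right_distributive qscale +%R.
Proof.
by move=> a p q; rewrite -[p]qpi_repr -[q]qpi_repr -qpiD !qscale_pi scalerDr qpiD.
Qed.
Lemma qscaleDl q : {morph qscale^~ q : a b / a + b}.
Proof. by move=> a b; rewrite -[q]qpi_repr !qscale_pi scalerDl qpiD. Qed.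

HB.instance Definition _ :=
  GRing.Zmodule_isLmodule.Build k quotspan qscaleA qscale1 qscaleDr qscaleDl.

Lemma qpi_linear : linear qpi.
Proof. by move=> a x y; rewrite qpiD -qscale_pi. Qed.
HB.instance Definition _ := GRing.isLinear.Build k M quotspan *:%R qpi qpi_linear.

Lemma qpi_eq0 x : S x -> qpi x = 0.
Proof. by move=> Sx; rewrite -(raddf0 qpi); apply/qpiE; rewrite subr0; apply: kspan_incl. Qed.

Section Lift.
Variables (N : lmodType k) (f : {linear M -> N}).
Hypothesis fS : forall x, S x -> f x = 0.

Definition qlift (q : quotspan) : N := f (repr q).

Lemma qlift_pi x : qlift (qpi x) = f x.
Proof.
apply/eqP; rewrite -subr_eq0 -linearB; apply/eqP.
have: kspan (repr (qpi x) - x) by apply/qpiE; rewrite qpi_repr.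
elim/kspan_ind => [|y z|a y|y /fS //]; first exact: linear0.
- by rewrite linearD => -> ->; rewrite addr0.
- by rewrite linearZZ => ->; rewrite scaler0.
Qed.

Lemma qlift_linear : linear qlift.
Proof.
by move=> a p q; rewrite -[p]qpi_repr -[q]qpi_repr -linearP !qlift_pi linearP.
Qed.
End Lift.

End Span.

Section FreeModule.
Variables (k : pzRingType) (T : choiceType).

Definition fdelta (t : T) : T -> k^o := fun s => (s == t)%:R.

(* The free k-module on T: the finitely supported functions T -> k. *)
Definition freemod := spanmod (range fdelta).

HB.instance Definition _ := GRing.Lmodule.on freemod.

Definition fgen (t : T) : freemod := inSpan (kspan_incl (imageT fdelta t)).

Lemma freemod_finsupp (f : freemod) : finite_set [set t | spanval f t != 0].
Proof.
case: f => h /= /inspanP hS; elim/kspan_ind: hS => {h} [|f g ff fg|a f ff|_ [t _ <-]].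
- by apply: (sub_finite_set (B := set0)) => // t /=; rewrite eqxx.
- apply: (sub_finite_set (B := [set t | f t != 0] `|` [set t | g t != 0])).
    move=> t /= fgt; apply/orP; rewrite -negb_and; apply: contraNN fgt.
    by move=> /andP[/eqP f0 /eqP g0]; rewrite addrfctE f0 g0 addr0.
  by rewrite finite_setU.
- apply: (sub_finite_set _ ff) => t /=; apply: contra_neq => f0.
  by rewrite scalrfctE f0 scaler0.
- apply: (sub_finite_set (B := [set t])) => // s /=.
  by rewrite /fdelta; case: (s =P t) => //= _; rewrite eqxx.
Qed.

Section Lift.
Variables (M : lmodType k) (g : T -> M).

Definition flift (f : freemod) : M := \sum_(t \in [set: T]) (spanval f t : k) *: g t.

Lemma flift_seq (f : freemod) (r : seq T) : uniq r ->
  (forall t, spanval f t != 0 -> t \in r) ->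
  flift f = \sum_(t <- r) (spanval f t : k) *: g t.
Proof.
move=> ur fr; rewrite /flift (fsbigE r) //.
  by rewrite big_mkcond; apply: eq_bigr => t _; rewrite in_setT.
move=> t _; apply: contraNeq => ft; apply: fr; apply: contra_neq ft => ->.
exact: scale0r.
Qed.

Lemma flift_linear : linear flift.
Proof.
move=> a f h; pose r := fset_set ([set t | spanval f t != 0] `|` [set t | spanval h t != 0]).
have inr t : (t \in r) = (spanval f t != 0) || (spanval h t != 0).
  rewrite in_fset_set ?finite_setU; last by split; exact: freemod_finsupp.
  by apply/idP/orP; rewrite inE.
rewrite !(@flift_seq _ r) ?fset_uniq // => [|t th|t tf|t].
- rewrite scaler_sumr -big_split /=; apply: eq_bigr => t _.
  by rewrite scalerA -scalerDl.
- by rewrite inr th orbT.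
- by rewrite inr tf.
rewrite inr; apply: contra_neqT; rewrite negb_or !negbK => /andP[/eqP f0 /eqP h0].
rewrite -[LHS]/(spanval (a *: f + h) t) (_ : spanval (a *: f + h) = a *: spanval f + spanval h) // addrfctE scalrfctE f0 h0 scaler0 addr0 //.
Qed.
HB.instance Definition _ := GRing.isLinear.Build k freemod M *:%R flift flift_linear.

Lemma flift_gen t : flift (fgen t) = g t.
Proof.
rewrite (@flift_seq _ [:: t]) //= => [|s].
  by rewrite big_seq1 /= /fdelta eqxx scale1r.
by rewrite /fdelta inE; apply: contra_neqT => /negPf ->.
Qed.
End Lift.
End FreeModule.

HB.mixin Record Lmodule_isLieAlgebra (k : comPzRingType) L of GRing.Lmodule k L := {
  lie : L -> L -> L;
  lie_linearl : forall (a : k) (x y z : L), lie (a *: x + y) z = a *: lie x z + lie y z;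
  lie_linearr : forall (a : k) (x y z : L), lie z (a *: x + y) = a *: lie z x + lie z y;
  lie_alt : forall x : L, lie x x = 0;
  lie_jacobi : forall x y z : L,
    lie x (lie y z) + lie y (lie z x) + lie z (lie x y) = 0
}.

#[short(type="lieAlgType")]
HB.structure Definition LieAlgebra (k : comPzRingType) :=
  {L of Lmodule_isLieAlgebra k L & GRing.Lmodule k L}.

Section UCE.
Variables (k : comPzRingType) (L : lieAlgType k).

Local Notation F := (freemod k (L * L)%type).

Definition ext_rel : set F :=
  [set r | (exists a x y z,
             r = fgen k (a *: x + y, z) - (a *: fgen k (x, z) + fgen k (y, z))) \/
           (exists a x y z,
             r = fgen k (z, a *: x + y) - (a *: fgen k (z, x) + fgen k (z, y))) \/
           (exists x, r = fgen k (x, x))].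

(* The exterior square of the k-module L. *)
Definition extsq := quotspan ext_rel.
HB.instance Definition _ := GRing.Lmodule.on extsq.

Definition wedge (x y : L) : extsq := qpi ext_rel (fgen k (x, y)).

Definition uce_rel : set extsq :=
  [set w | exists x y z, w = wedge x (lie y z) + wedge y (lie z x) + wedge z (lie x y)].

Definition uce := quotspan uce_rel.
HB.instance Definition _ := GRing.Lmodule.on uce.

Definition uang (x y : L) : uce := qpi uce_rel (wedge x y).

Definition extlie : F -> L := flift (fun p => lie p.1 p.2).
HB.instance Definition _ := GRing.Linear.on extlie.

Lemma extlie_rel r : ext_rel r -> extlie r = 0.
Proof.
move=> [[a [x [y [z ->]]]]|[[a [x [y [z ->]]]]|[x ->]]].
- by rewrite /extlie linearB linearP /= !flift_gen /= lie_linearl subrr.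
- by rewrite /extlie linearB linearP /= !flift_gen /= lie_linearr subrr.
- by rewrite /extlie flift_gen lie_alt.
Qed.

Definition umap_ext : extsq -> L := qlift extlie.
HB.instance Definition _ :=
  GRing.isLinear.Build k extsq L *:%R umap_ext (qlift_linear extlie_rel).

Lemma umap_ext_wedge x y : umap_ext (wedge x y) = lie x y.
Proof. by rewrite /umap_ext qlift_pi; [exact: flift_gen | exact: extlie_rel]. Qed.

Lemma umap_ext_rel w : uce_rel w -> umap_ext w = 0.
Proof.
by move=> [x [y [z ->]]]; rewrite !linearD /= !umap_ext_wedge lie_jacobi.
Qed.

Definition umap : uce -> L := qlift umap_ext.
HB.instance Definition _ :=
  GRing.isLinear.Build k uce L *:%R umap (qlift_linear umap_ext_rel).

Lemma umapE x y : umap (uang x y) = lie x y.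
Proof. by rewrite /umap qlift_pi; [exact: umap_ext_wedge | exact: umap_ext_rel]. Qed.

Lemma uang_linearl a x y z : uang (a *: x + y) z = a *: uang x z + uang y z.
Proof.
rewrite /uang -linearP; congr (qpi _ _); rewrite /wedge -linearP; apply/qpiE.
by apply: kspan_incl; left; exists a, x, y, z.
Qed.

Lemma uang_linearr a x y z : uang z (a *: x + y) = a *: uang z x + uang z y.
Proof.
rewrite /uang -linearP; congr (qpi _ _); rewrite /wedge -linearP; apply/qpiE.
by apply: kspan_incl; right; left; exists a, x, y, z.
Qed.

Lemma uang_alt x : uang x x = 0.
Proof.
rewrite /uang (_ : wedge x x = 0) ?linear0 //.
by apply: qpi_eq0; right; right; exists x.
Qed.

Definition uce_lie (X Y : uce) : uce := uang (umap X) (umap Y).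

Lemma uce_lie_linearl a (X Y Z : uce) :
  uce_lie (a *: X + Y) Z = a *: uce_lie X Z + uce_lie Y Z.
Proof. by rewrite /uce_lie linearP uang_linearl. Qed.
Lemma uce_lie_linearr a (X Y Z : uce) :
  uce_lie Z (a *: X + Y) = a *: uce_lie Z X + uce_lie Z Y.
Proof. by rewrite /uce_lie linearP uang_linearr. Qed.
Lemma uce_lie_alt X : uce_lie X X = 0.
Proof. exact: uang_alt. Qed.
Lemma uce_lie_jacobi X Y Z :
  uce_lie X (uce_lie Y Z) + uce_lie Y (uce_lie Z X) + uce_lie Z (uce_lie X Y) = 0.
Proof.
rewrite /uce_lie !umapE /uang -2!(linearD (qpi uce_rel)); apply: qpi_eq0.
by exists (umap X), (umap Y), (umap Z).
Qed.

HB.instance Definition _ := Lmodule_isLieAlgebra.Build k uce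
  uce_lie_linearl uce_lie_linearr uce_lie_alt uce_lie_jacobi.

End UCE.

Section KMatrices.
Variables (k : comPzRingType) (D : algType k).

(* Matrices over D as a k-module (the library structure on 'M[D]_(m, n) is the
   one of a left D-module). *)
Definition kmx m n : Type := 'M[D]_(m, n).

HB.instance Definition _ m n := GRing.Zmodule.on (kmx m n).

Definition kmx_scale m n (a : k) (A : kmx m n) : kmx m n := \matrix_(i, j) (a *: A i j).

Lemma kmx_scaleA m n a b (A : kmx m n) :
  kmx_scale a (kmx_scale b A) = kmx_scale (a * b) A.
Proof. by apply/matrixP => i j; rewrite !mxE scalerA. Qed.
Lemma kmx_scale1 m n : left_id 1 (@kmx_scale m n).
Proof. by move=> A; apply/matrixP => i j; rewrite !mxE scale1r. Qed.
Lemma kmx_scaleDr m n : right_distributive (@kmx_scale m n) +%R.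
Proof. by move=> a A B; apply/matrixP => i j; rewrite !mxE scalerDr. Qed.
Lemma kmx_scaleDl m n (A : kmx m n) : {morph (@kmx_scale m n)^~ A : a b / a + b}.
Proof. by move=> a b; apply/matrixP => i j; rewrite !mxE scalerDl. Qed.

HB.instance Definition _ m n := GRing.Zmodule_isLmodule.Build k (kmx m n)
  (@kmx_scaleA m n) (@kmx_scale1 m n) (@kmx_scaleDr m n) (@kmx_scaleDl m n).

Definition kmul m n p (A : kmx m n) (B : kmx n p) : kmx m p := mulmx A B.

Local Notation "A ** B" := (kmul A B) (at level 40, left associativity).

Lemma kmulA m n p q (A : kmx m n) (B : kmx n p) (C : kmx p q) :
  A ** (B ** C) = A ** B ** C.
Proof. exact: mulmxA. Qed.
Lemma kmulDl m n p (A B : kmx m n) (C : kmx n p) : (A + B) ** C = A ** C + B ** C.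
Proof. exact: mulmxDl. Qed.
Lemma kmulDr m n p (A : kmx m n) (B C : kmx n p) : A ** (B + C) = A ** B + A ** C.
Proof. exact: mulmxDr. Qed.
Lemma kmulZl m n p a (A : kmx m n) (B : kmx n p) : (a *: A) ** B = a *: (A ** B).
Proof.
apply/matrixP => i j; rewrite !mxE scaler_sumr.
by apply: eq_bigr => l _; rewrite !mxE scalerAl.
Qed.
Lemma kmulZr m n p a (A : kmx m n) (B : kmx n p) : A ** (a *: B) = a *: (A ** B).
Proof.
apply/matrixP => i j; rewrite !mxE scaler_sumr.
by apply: eq_bigr => l _; rewrite !mxE scalerAr.
Qed.

(* {x y z} = xyz + zyx, the linearization of Q_x(y) = xyx; for (m, n) = (1, 3) and
   (3, 1) these are the two triple products of the Jordan pair V^+ = Mat(1, J, D),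
   V^- = Mat(J, 1, D) with J = {2, 3, 4}. *)
Definition jtriple m n (x : kmx m n) (y : kmx n m) (z : kmx m n) : kmx m n :=
  x ** y ** z + z ** y ** x.

Lemma jtripleC m n (x z : kmx m n) y : jtriple x y z = jtriple z y x.
Proof. by rewrite /jtriple addrC. Qed.

Lemma jtriple_linear1 m n a (x x' : kmx m n) y z :
  jtriple (a *: x + x') y z = a *: jtriple x y z + jtriple x' y z.
Proof. by rewrite /jtriple !(kmulDl, kmulDr, kmulZl, kmulZr) scalerDr addrACA. Qed.

Lemma jtriple_linear2 m n a (x z : kmx m n) y y' :
  jtriple x (a *: y + y') z = a *: jtriple x y z + jtriple x y' z.
Proof. by rewrite /jtriple !(kmulDl, kmulDr, kmulZl, kmulZr) scalerDr addrACA. Qed.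

Lemma jtriple_linear3 m n a (z z' x : kmx m n) y :
  jtriple x y (a *: z + z') = a *: jtriple x y z + jtriple x y z'.
Proof. by rewrite !(jtripleC x) jtriple_linear1. Qed.

Lemma jtripleN2 m n (x z : kmx m n) y : jtriple x (- y) z = - jtriple x y z.
Proof. by rewrite /jtriple /kmul !(mulmxN, mulNmx) opprD. Qed.

Lemma jtripleN3 m n (x z : kmx m n) y : jtriple x y (- z) = - jtriple x y z.
Proof. by rewrite /jtriple /kmul !(mulmxN, mulNmx) opprD. Qed.

Lemma jtriple_jordan m n (x u z : kmx m n) (y v : kmx n m) :
  jtriple x y (jtriple u v z) - jtriple u v (jtriple x y z) =
  jtriple (jtriple x y u) v z - jtriple u (jtriple y x v) z.
Proof.
rewrite /jtriple !(kmulDl, kmulDr, kmulA).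
rewrite !opprD !addrA [LHS](ACl (1*4*5*8*(2*7)*(3*6))) /=.
by rewrite [RHS](ACl (1*4*6*7*(2*5)*(3*8))) /= !subrr !addr0.
Qed.

End KMatrices.

Section TKK.
Variables (k : comPzRingType) (D : algType k).

(* J = {2, 3, 4} is 'I_3, with index i : 'I_3 standing for i + 2. *)
Definition Vp := kmx D 1 3.
Definition Vm := kmx D 3 1.
HB.instance Definition _ := GRing.Lmodule.on Vp.
HB.instance Definition _ := GRing.Lmodule.on Vm.

Definition endV := ((Vp -> Vp) * (Vm -> Vm))%type.
HB.instance Definition _ := GRing.Lmodule.on endV.

Definition jdelta (x : Vp) (y : Vm) : endV :=
  (fun z => jtriple x y z, fun w => - jtriple y x w).

(* The span is taken inside all pairs of maps; as each jdelta x y is a pair of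
   linear maps, so are all elements of the span (ider_linear below). *)
Definition ider_gen : set endV := [set T | exists x y, T = jdelta x y].

Definition ider := spanmod ider_gen.
HB.instance Definition _ := GRing.Lmodule.on ider.

Definition jdelta_in x y : kspan ider_gen (jdelta x y) :=
  kspan_incl (ex_intro _ x (ex_intro _ y erefl)).

Definition ider_delta x y : ider := inSpan (jdelta_in x y).

Lemma iderP (T : ider) : kspan ider_gen (spanval T).
Proof. by case: T => T /= /inspanP. Qed.

Lemma span_ider_linear (T : endV) : kspan ider_gen T -> linear T.1 /\ linear T.2.
Proof.
elim/kspan_ind => [|S1 S2 [l1 m1] [l2 m2]|a S1 [l m]|_ [x [y ->]]]; split=> b u v /=.
- have e : 0 = b *: 0 + 0 :> Vp by rewrite scaler0 addr0.
  exact: e.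
- have e : 0 = b *: 0 + 0 :> Vm by rewrite scaler0 addr0.
  exact: e.
- by rewrite !addrfctE l1 l2 scalerDr addrACA.
- by rewrite !addrfctE m1 m2 scalerDr addrACA.
- by rewrite !scalrfctE l scalerDr !scalerA mulrC.
- by rewrite !scalrfctE m scalerDr !scalerA mulrC.
- by rewrite jtriple_linear3.
- by rewrite jtriple_linear3 opprD scalerN.
Qed.

Definition actp (T : ider) : Vp -> Vp := (spanval T).1.
Definition actm (T : ider) : Vm -> Vm := (spanval T).2.

Lemma ider_linear (T : ider) : linear (actp T) /\ linear (actm T).
Proof. exact: (span_ider_linear (iderP T)). Qed.

HB.instance Definition _ (T : ider) :=
  GRing.isLinear.Build k Vp Vp *:%R (actp T) (ider_linear T).1.
HB.instance Definition _ (T : ider) :=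
  GRing.isLinear.Build k Vm Vm *:%R (actm T) (ider_linear T).2.

Lemma actpP a (T T' : ider) z : actp (a *: T + T') z = a *: actp T z + actp T' z.
Proof. by []. Qed.
Lemma actmP a (T T' : ider) z : actm (a *: T + T') z = a *: actm T z + actm T' z.
Proof. by []. Qed.

Lemma ider_ext (T T' : ider) : actp T =1 actp T' -> actm T =1 actm T' -> T = T'.
Proof.
move=> Tp Tm; apply: val_inj; rewrite /= [LHS]surjective_pairing [RHS]surjective_pairing.
by congr pair; apply/funext.
Qed.

Definition endcomm (T T' : endV) : endV :=
  (fun z => T.1 (T'.1 z) - T'.1 (T.1 z), fun w => T.2 (T'.2 w) - T'.2 (T.2 w)).

Lemma jdelta_linearl a x x' y :
  jdelta (a *: x + x') y = a *: jdelta x y + jdelta x' y.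
Proof.
congr pair; apply/funext => z /=; first exact: jtriple_linear1.
by rewrite jtriple_linear2 opprD -scalerN.
Qed.

Lemma jdelta_linearr a x y y' :
  jdelta x (a *: y + y') = a *: jdelta x y + jdelta x y'.
Proof.
congr pair; apply/funext => z /=; first exact: jtriple_linear2.
by rewrite jtriple_linear1 opprD -scalerN.
Qed.

Lemma endcommN (T T' : endV) : endcomm T' T = - endcomm T T'.
Proof. by congr pair; apply/funext => z /=; rewrite opprfctE opprB. Qed.

Lemma endcomm_linearl a (S1 S2 T : endV) : kspan ider_gen T ->
  endcomm (a *: S1 + S2) T = a *: endcomm S1 T + endcomm S2 T.
Proof.
move=> /span_ider_linear [l m]; congr pair; apply/funext => z /=.
  by rewrite !addrfctE !scalrfctE l opprD addrACA -scalerBr.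
by rewrite !addrfctE !scalrfctE m opprD addrACA -scalerBr.
Qed.

Lemma linear_fun0 (U V : lmodType k) (f : U -> V) : linear f -> f 0 = 0.
Proof. by move=> /(_ (-1) 0 0); rewrite scaler0 addr0 scaleN1r addNr. Qed.

Lemma endcomm_delta (T : endV) x y : kspan ider_gen T ->
  endcomm T (jdelta x y) = jdelta (T.1 x) y + jdelta x (T.2 y).
Proof.
have lind : linear (fun T : endV => jdelta (T.1 x) y + jdelta x (T.2 y)).
  by move=> a S1 S2 /=; rewrite jdelta_linearl jdelta_linearr scalerDr addrACA.
have linc : linear (fun T : endV => endcomm T (jdelta x y)).
  by move=> a S1 S2; apply: endcomm_linearl; apply: jdelta_in.
elim/kspan_ind_lin => [|a S1 S2 h1 h2|_ [u [v ->]]].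
- by rewrite (linear_fun0 linc) (linear_fun0 lind).
- by rewrite linc h1 h2 lind.
congr pair; apply/funext => z /=.
  rewrite jtriple_jordan addrfctE /=; congr (_ + _).
  exact/esym/jtripleN2.
rewrite !jtripleN3 !opprK jtriple_jordan addrfctE [RHS]addrC /=; congr (_ + _).
by rewrite (jtripleC (- _)) jtripleN3 opprK jtripleC.
Qed.

Lemma endcomm_in (T T' : endV) :
  kspan ider_gen T -> kspan ider_gen T' -> kspan ider_gen (endcomm T T').
Proof.
move=> hT; elim/kspan_ind_lin => [|a S1 S2 h1 h2|_ [u [v ->]]].
- rewrite endcommN (linear_fun0 (fun a b c => endcomm_linearl a b c hT)) oppr0.
  exact: kspan0.
- rewrite endcommN endcomm_linearl // opprD -scalerN -!endcommN.
  by apply: kspanD => //; apply: kspanZ.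
- by rewrite endcomm_delta //; apply: kspanD; apply: jdelta_in.
Qed.

Definition ider_comm (T T' : ider) : ider := inSpan (endcomm_in (iderP T) (iderP T')).

Lemma actp_comm T T' z : actp (ider_comm T T') z = actp T (actp T' z) - actp T' (actp T z).
Proof. by []. Qed.
Lemma actm_comm T T' z : actm (ider_comm T T') z = actm T (actm T' z) - actm T' (actm T z).
Proof. by []. Qed.
Lemma actp_delta x y z : actp (ider_delta x y) z = jtriple x y z.
Proof. by []. Qed.
Lemma actm_delta x y z : actm (ider_delta x y) z = - jtriple y x z.
Proof. by []. Qed.

Lemma ider_delta_linearl a x x' y :
  ider_delta (a *: x + x') y = a *: ider_delta x y + ider_delta x' y.
Proof. by apply: val_inj; exact: jdelta_linearl. Qed.

Lemma ider_delta_linearr a x y y' :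
  ider_delta x (a *: y + y') = a *: ider_delta x y + ider_delta x y'.
Proof. by apply: val_inj; exact: jdelta_linearr. Qed.

Lemma ider_deltaBl x x' y : ider_delta (x - x') y = ider_delta x y - ider_delta x' y.
Proof. by rewrite addrC -scaleN1r ider_delta_linearl scaleN1r addrC. Qed.

Lemma ider_deltaBr x y y' : ider_delta x (y - y') = ider_delta x y - ider_delta x y'.
Proof. by rewrite addrC -scaleN1r ider_delta_linearr scaleN1r addrC. Qed.

Lemma ider_commN T T' : ider_comm T' T = - ider_comm T T'.
Proof. by apply: val_inj; exact: endcommN. Qed.

Lemma ider_comm_linearl a T T' S :
  ider_comm (a *: T + T') S = a *: ider_comm T S + ider_comm T' S.
Proof. by apply: val_inj; apply: endcomm_linearl; exact: iderP. Qed.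

Lemma ider_comm_linearr a T T' S :
  ider_comm S (a *: T + T') = a *: ider_comm S T + ider_comm S T'.
Proof. by rewrite ider_commN ider_comm_linearl opprD -scalerN -!ider_commN. Qed.

Lemma ider_commDr T T' S : ider_comm S (T + T') = ider_comm S T + ider_comm S T'.
Proof. by rewrite -[T]scale1r ider_comm_linearr !scale1r. Qed.

Lemma ider_commBr T T' S : ider_comm S (T - T') = ider_comm S T - ider_comm S T'.
Proof. by rewrite addrC -scaleN1r ider_comm_linearr scaleN1r addrC. Qed.

Lemma ider_comm_alt T : ider_comm T T = 0.
Proof. by apply: ider_ext => z; [rewrite actp_comm | rewrite actm_comm]; rewrite subrr. Qed.

Lemma ider_comm_delta T x y :
  ider_comm T (ider_delta x y) = ider_delta (actp T x) y + ider_delta x (actm T y).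
Proof. by apply: val_inj; apply: endcomm_delta; exact: iderP. Qed.

Lemma ider_comm_jacobi T1 T2 T3 :
  ider_comm T1 (ider_comm T2 T3) + ider_comm T2 (ider_comm T3 T1)
  + ider_comm T3 (ider_comm T1 T2) = 0.
Proof.
have jac (V : zmodType) (f g h : {additive V -> V}) z :
    f (g (h z) - h (g z)) - (g (h (f z)) - h (g (f z)))
    + (g (h (f z) - f (h z)) - (h (f (g z)) - f (h (g z))))
    + (h (f (g z) - g (f z)) - (f (g (h z)) - g (f (h z)))) = 0.
  rewrite (raddfB f) (raddfB g) (raddfB h).
  rewrite !opprD !opprK !addrA.
  rewrite (ACl ((1*11)*(8*2)*(5*3)*(4*10)*(12*6)*(9*7))) /=.
  by rewrite !subrr !addr0.
by apply: ider_ext => z; [exact: (jac Vp (actp T1) (actp T2) (actp T3)) | exact: (jac Vm (actm T1) (actm T2) (actm T3))].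
Qed.

(* TKK(V) = V^+ + ider(V) + V^- *)
Definition TKK := (Vp * ider * Vm)%type.
HB.instance Definition _ := GRing.Lmodule.on TKK.

Definition tkk_lie (X Y : TKK) : TKK :=
  let: (x, T, y) := X in let: (x', T', y') := Y in
  (actp T x' - actp T' x,
   ider_comm T T' + ider_delta x y' - ider_delta x' y,
   actm T y' - actm T' y).

Lemma tkk_lie_linearl a (X Y Z : TKK) :
  tkk_lie (a *: X + Y) Z = a *: tkk_lie X Z + tkk_lie Y Z.
Proof.
case: X Y Z => [[x1 T1] y1] [[x2 T2] y2] [[x3 T3] y3]; congr (_, _, _) => /=.
- by rewrite actpP linearP opprD addrACA -scalerBr.
- rewrite ider_comm_linearl ider_delta_linearl ider_delta_linearr.
  by rewrite [X in X - _]addrACA opprD [LHS]addrACA -scalerN -!scalerDr.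
- by rewrite actmP linearP opprD addrACA -scalerBr.
Qed.

Lemma tkk_lieN (X Y : TKK) : tkk_lie Y X = - tkk_lie X Y.
Proof.
case: X Y => [[x1 T1] y1] [[x2 T2] y2]; congr (_, _, _) => /=; rewrite ?opprB //.
by rewrite opprD ider_commN addrA [in RHS](addrC (ider_delta _ _)).
Qed.

Lemma tkk_lie_linearr a (X Y Z : TKK) :
  tkk_lie Z (a *: X + Y) = a *: tkk_lie Z X + tkk_lie Z Y.
Proof. by rewrite tkk_lieN tkk_lie_linearl opprD -scalerN -!tkk_lieN. Qed.

Lemma tkk_lie_alt X : tkk_lie X X = 0.
Proof.
case: X => [[x T] y]; congr (_, _, _) => /=; rewrite ?subrr //.
by rewrite ider_comm_alt add0r subrr.
Qed.

Let actp3 (S1 S2 S3 : ider) z : actp (S1 + S2 - S3) z = actp S1 z + actp S2 z - actp S3 z.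
Proof. by []. Qed.
Let actm3 (S1 S2 S3 : ider) z : actm (S1 + S2 - S3) z = actm S1 z + actm S2 z - actm S3 z.
Proof. by []. Qed.

Let tkk_jacobi0 (x1 x2 x3 : Vp) (T1 T2 T3 : ider) (y1 y2 y3 : Vm) :
  ider_comm T1 (ider_comm T2 T3 + ider_delta x2 y3 - ider_delta x3 y2) +
  ider_delta x1 (actm T2 y3 - actm T3 y2) -
  ider_delta (actp T2 x3 - actp T3 x2) y1 +
  (ider_comm T2 (ider_comm T3 T1 + ider_delta x3 y1 - ider_delta x1 y3) +
   ider_delta x2 (actm T3 y1 - actm T1 y3) -
   ider_delta (actp T3 x1 - actp T1 x3) y2) +
  (ider_comm T3 (ider_comm T1 T2 + ider_delta x1 y2 - ider_delta x2 y1) +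
   ider_delta x3 (actm T1 y2 - actm T2 y1) -
   ider_delta (actp T1 x2 - actp T2 x1) y3) = 0.
Proof.
have DB S A B C : ider_comm S (A + B - C) = ider_comm S A + ider_comm S B - ider_comm S C.
  by rewrite ider_commBr ider_commDr.
rewrite !DB !ider_comm_delta !ider_deltaBl !ider_deltaBr.
have := ider_comm_jacobi T1 T2 T3.
move: (ider_comm T1 _) (ider_comm T2 _) (ider_comm T3 _) => a b c.
move: (ider_delta (actp T1 x2) y3) (ider_delta x2 (actm T1 y3))
  (ider_delta (actp T1 x3) y2) (ider_delta x3 (actm T1 y2)) => d1 d2 d3 d4.
move: (ider_delta (actp T2 x1) y3) (ider_delta x1 (actm T2 y3))
  (ider_delta (actp T2 x3) y1) (ider_delta x3 (actm T2 y1)) => d5 d6 d7 d8.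
move: (ider_delta (actp T3 x1) y2) (ider_delta x1 (actm T3 y2))
  (ider_delta (actp T3 x2) y1) (ider_delta x2 (actm T3 y1)) => d9 d10 d11 d12 abc.
rewrite !opprD !opprK !addrA.
rewrite (ACl ((1*10*19)*(2*26)*(3*16)*(18*4)*(24*5)*(6*14)*(21*7)*(11*8)*(9*22)
  *(12*25)*(27*13)*(15*23)*(20*17))) /=.
by rewrite !subrr !addr0.
Qed.

Lemma tkk_lie_jacobi X Y Z :
  tkk_lie X (tkk_lie Y Z) + tkk_lie Y (tkk_lie Z X) + tkk_lie Z (tkk_lie X Y) = 0.
Proof.
case: X Y Z => [[x1 T1] y1] [[x2 T2] y2] [[x3 T3] y3]; congr (_, _, _) => /=.
- rewrite !actp3 !actp_comm !actp_delta.
  rewrite (raddfB (actp T1)) (raddfB (actp T2)) (raddfB (actp T3)).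
  rewrite (jtripleC x3 x1) (jtripleC x1 x2) (jtripleC x2 x3).
  move: (jtriple x2 y3 x1) (jtriple x1 y2 x3) (jtriple x3 y1 x2) => a b c.
  rewrite !opprD !opprK !addrA.
  rewrite (ACl ((1*15)*(10*2)*(7*3)*(4*14)*(6*17)*(12*5)*(13*9)*(16*8)*(18*11))) /=.
  by rewrite !subrr !addr0.
- exact: tkk_jacobi0.
- rewrite !actm3 !actm_comm !actm_delta.
  rewrite (raddfB (actm T1)) (raddfB (actm T2)) (raddfB (actm T3)).
  rewrite (jtripleC y3 y1) (jtripleC y1 y2) (jtripleC y2 y3).
  move: (jtriple y2 x3 y1) (jtriple y1 x2 y3) (jtriple y3 x1 y2) => a b c.
  rewrite !opprD !opprK !addrA.
  rewrite (ACl ((1*15)*(10*2)*(7*3)*(4*14)*(5*18)*(11*6)*(13*9)*(16*8)*(17*12))) /=.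
  by rewrite !subrr !addr0.
Qed.

HB.instance Definition _ := Lmodule_isLieAlgebra.Build k TKK
  tkk_lie_linearl tkk_lie_linearr tkk_lie_alt tkk_lie_jacobi.

End TKK.

(* The index i : 'I_4 stands for i + 1. *)
Definition eps (i j : 'I_4) : 'rV[int]_4 := delta_mx 0 i - delta_mx 0 j.

Definition A3 : set 'rV[int]_4 := [set v | exists i j, v = eps i j].

(* Q(A_3), the Z-span of the roots *)
Definition rootlat : set 'rV[int]_4 := kspan A3.

Definition dot (v w : 'rV[int]_4) : int := \sum_i v 0 i * w 0 i.

(* <v, w^vee> = 2 (v, w) / (w, w). The division is exact for w in A3: (w, w) is
   2 when w <> 0, and the value is 0 for w = 0. *)
Definition coroot_pairing (v w : 'rV[int]_4) : int := ((2 * dot v w) %/ dot w w)%Z.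

Definition lin_indep2 (v w : 'rV[int]_4) : Prop :=
  forall a b : int, a *: v + b *: w = 0 -> a = 0 /\ b = 0.

Definition degenerate_sum (alpha beta : 'rV[int]_4) : Prop :=
  [/\ A3 alpha, A3 beta, lin_indep2 alpha beta &
   exists d : nat, (1 < d)%N /\
     forall delta, A3 delta -> (d%:Z %| coroot_pairing (alpha + beta) delta)%Z].

Section GradedTKK.
Variables (k : comPzRingType) (D : algType k).

Definition E1 (j : 'I_3) (a : D) : Vp D := \row_l (if l == j then a else 0).
Definition Em1 (j : 'I_3) (a : D) : Vm D := \col_l (if l == j then a else 0).

(* E_{ij}(a); meaningful for i <> j only. *)
Definition Eij (i j : 'I_4) (a : D) : TKK D :=
  match unlift ord0 i, unlift ord0 j with
  | None, Some j' => (E1 j' a, 0, 0)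
  | Some i', None => (0, 0, Em1 i' a)
  | Some i', Some j' => (0, - ider_delta (E1 j' a) (Em1 i' 1), 0)
  | None, None => 0
  end.

Definition tkk0 : set (TKK D) :=
  kspan [set X | exists (j : 'I_4) (a b : D),
                   j != ord0 /\ X = lie (Eij ord0 j a) (Eij j ord0 b)].

Definition tkk_gr (gamma : 'rV[int]_4) : set (TKK D) :=
  [set X | [\/ gamma = 0 /\ tkk0 X,
               exists i j a, [/\ i != j, gamma = eps i j & X = Eij i j a] |
               X = 0]].

Definition uce_gr_gen (gamma : 'rV[int]_4) : set (uce (TKK D)) :=
  [set X | exists delta x y,
     [/\ rootlat delta, tkk_gr delta x, tkk_gr (gamma - delta) y & X = uang x y]].

Definition uce_gr gamma := spanmod (uce_gr_gen gamma).
HB.instance Definition _ gamma := GRing.Lmodule.on (uce_gr gamma).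

Definition uce_supp : set 'rV[int]_4 :=
  [set gamma | rootlat gamma /\ exists X : uce_gr gamma, X != 0].

(* x_alpha(a), picked by choice (default 0): for alpha = eps_i - eps_j, i <> j, it
   is the unique X in uce(L)_alpha with u(X) = E_{ij}(a). *)
Definition xroot (alpha : 'rV[int]_4) (a : D) : uce (TKK D) :=
  xget 0 [set X | kspan (uce_gr_gen alpha) X /\
                  exists i j, [/\ i != j, alpha = eps i j & umap X = Eij i j a]].

(* The k-span of the x s y (s in 2D or s a commutator) is the two-sided ideal
   generated by 2D and [D, D]. *)
Definition D2_ideal_gen : set D :=
  [set z | exists x s y, z = x * s * y /\
     ((exists d, s = d *+ 2) \/ (exists a b, s = a * b - b * a))].

Definition D2 := quotspan D2_ideal_gen.
HB.instance Definition _ := GRing.Lmodule.on D2.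

Definition D2bar (a : D) : D2 := qpi D2_ideal_gen a.

End GradedTKK.

(* Main.v *)
(* If a degree gamma outside the roots occurs, it is a sum of two roots
   eps_i - eps_j and eps_p - eps_q. When i = p or j = q, writing E_ij(a) as a
   bracket through a fourth index kills <E_ij(a), E_pq(b)>, so the four indices are
   distinct. In that case writing E_ij(ab) as [E_ip(a), E_pj(b)] and as
   [E_iq(a), E_qj(b)] shows that the component is the image of
   h(a) = <E_ij(a), E_pq(1)>, where h = - h and h(abc) = h(acb); hence h factors
   through D_2.

   Injectivity needs a cocycle. Reducing L modulo the ideal defining D_2 gives
   4 x 4 matrices of trace 0 over the commutative ring D_2 of characteristic 2,
   up to scalar matrices, and there the polarization of the minor with rows i, p
   and columns j, q is an alternating 2-cocycle taking the value ab on
   (E_ij(a), E_pq(b)). *)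
Require Import Defs.
From HB Require Import structures.
From mathcomp Require Import all_boot all_order all_algebra.
From mathcomp Require Import ring.
From mathcomp Require Import boolp classical_sets functions.

Set Implicit Arguments.
Unset Strict Implicit.
Unset Printing Implicit Defensive.

Import GRing.Theory.
Local Open Scope classical_set_scope.
Local Open Scope ring_scope.

(** * The commutative ring structure on [D2] *)

Section D2Ring.
Variables (k : comPzRingType) (D : algType k).

Lemma D2_ideal_mull (z x : D) : kspan (@D2_ideal_gen k D) x -> kspan (@D2_ideal_gen k D) (z * x).
Proof.
elim/kspan_ind => [|u v hu hv|a u hu|_ [u [s [v [-> hs]]]]].
- by rewrite mulr0; exact: kspan0.
- by rewrite mulrDr; apply: kspanD.
- by rewrite -scalerAr; apply: kspanZ.
- by apply: kspan_incl; exists (z * u), s, v; rewrite !mulrA.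
Qed.

Lemma D2_ideal_mulr (z x : D) : kspan (@D2_ideal_gen k D) x -> kspan (@D2_ideal_gen k D) (x * z).
Proof.
elim/kspan_ind => [|u v hu hv|a u hu|_ [u [s [v [-> hs]]]]].
- by rewrite mul0r; exact: kspan0.
- by rewrite mulrDl; apply: kspanD.
- by rewrite -scalerAl; apply: kspanZ.
- by apply: kspan_incl; exists u, s, (v * z); rewrite !mulrA.
Qed.

Lemma D2bar_reprK (q : D2 D) : D2bar (repr q) = q.
Proof. exact: qpi_repr. Qed.

Definition D2mul (p q : D2 D) : D2 D := D2bar (repr p * repr q).

Lemma D2bar_mul (a b : D) : D2mul (D2bar a) (D2bar b) = D2bar (a * b).
Proof.
(* The representatives are exchanged one factor at a time, with [a * repr (D2bar b)] as the
   intermediate product. *)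
apply/qpiE; rewrite -(subrKA (a * repr (D2bar b))) -mulrBl -mulrBr.
by apply: kspanD; [apply: D2_ideal_mulr|apply: D2_ideal_mull]; apply/qpiE; exact: D2bar_reprK.
Qed.

Fact D2mulA : associative D2mul.
Proof.
move=> p q r; rewrite -[p]D2bar_reprK -[q]D2bar_reprK -[r]D2bar_reprK.
by rewrite !D2bar_mul mulrA.
Qed.

Fact D2mulC : commutative D2mul.
Proof.
move=> p q; apply/qpiE/kspan_incl; exists 1, (repr p * repr q - repr q * repr p), 1.
by rewrite mul1r mulr1; split=> //; right; exists (repr p), (repr q).
Qed.

Fact D2mul1 : left_id (D2bar 1) D2mul.
Proof. by move=> p; rewrite -[p]D2bar_reprK D2bar_mul mul1r. Qed.

Fact D2mulDl : left_distributive D2mul +%R.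
Proof.
move=> p q r; rewrite -[p]D2bar_reprK -[q]D2bar_reprK -[r]D2bar_reprK.
by rewrite -(linearD (qpi _)) !D2bar_mul mulrDl; exact: (linearD (qpi _)).
Qed.

HB.instance Definition _ :=
  GRing.Zmodule_isComPzRing.Build (D2 D) D2mulA D2mulC D2mul1 D2mulDl.

HB.instance Definition _ := GRing.Linear.copy (@D2bar k D) (qpi (@D2_ideal_gen k D)).

Lemma D2barM (a b : D) : D2bar (a * b) = D2bar a * D2bar b.
Proof. exact/esym/D2bar_mul. Qed.

(** Turns scalars of [k] into ring elements, so that [ring] can settle linearity of forms with
    values in [D2]. *)
Lemma D2scaleE (a : k) (q : D2 D) : a *: q = D2bar a%:A * q.
Proof. by rewrite -[q]D2bar_reprK -linearZ -D2barM -scalerAl mul1r. Qed.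

Lemma D2_char2 (q : D2 D) : q + q = 0.
Proof.
rewrite -[q]D2bar_reprK -linearD /=; apply: qpi_eq0.
exists 1, (repr q *+ 2), 1; rewrite mul1r mulr1 mulr2n; split=> //.
by left; exists (repr q); rewrite mulr2n.
Qed.

Lemma D2_opp (q : D2 D) : - q = q.
Proof. by apply/eqP; rewrite eq_sym -addr_eq0 D2_char2. Qed.

End D2Ring.

(** * Combinatorics of four indices *)

Lemma ord4_avoid (i j l : 'I_4) : exists m, [/\ m != i, m != j & m != l].
Proof.
case: (pickP [pred m | m \notin [:: i; j; l]]) => [m|out].
  by rewrite /= !inE !negb_or => /and3P[mi mj ml]; exists m.
have /(uniq_leq_size (enum_uniq 'I_4)): {subset enum 'I_4 <= [:: i; j; l]}.
  by move=> m _; apply/negPn/negbT/out.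
by rewrite size_enum_ord.
Qed.

Lemma uniq4P (T : eqType) (i j p q : T) : uniq [:: i; j; p; q] ->
  [/\ i != j, p != q, i != q & p != j] /\ [/\ i != p, j != q & j != p].
Proof.
rewrite /= !inE !negb_or => /and4P[/and3P[-> -> ->] /andP[jp ->] -> _].
by rewrite jp eq_sym jp.
Qed.

(** A further index would give five distinct elements of ['I_4]. *)
Lemma mem_uniq4 (i j p q l : 'I_4) : uniq [:: i; j; p; q] -> l \in [:: i; j; p; q].
Proof.
move=> u; apply/negPn/negP => lN; have u' : uniq [:: l; i; j; p; q] by rewrite cons_uniq lN.
by have := max_card [in [:: l; i; j; p; q]]; rewrite (card_uniqP u') card_ord.
Qed.

(** * Bracket calculus in a Lie algebra and its universal central extension *)

Section LieAlgebraTheory.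
Variables (k : comPzRingType) (L : lieAlgType k).
Implicit Types (x y z : L).

Lemma lieN x y : lie x y = - lie y x.
Proof.
apply/eqP; rewrite -addr_eq0.
have lieDl u v w : lie (u + v) w = lie u w + lie v w :> L.
  by rewrite -[u]scale1r lie_linearl !scale1r.
have lieDr u v w : lie w (u + v) = lie w u + lie w v :> L.
  by rewrite -[u]scale1r lie_linearr !scale1r.
have := lie_alt (x + y); rewrite lieDl !lieDr !lie_alt add0r addr0.
by move=> ->.
Qed.

Lemma uangDl x y z : uang (x + y) z = uang x z + uang y z.
Proof. by rewrite -[x]scale1r uang_linearl !scale1r. Qed.

Lemma uangDr x y z : uang z (x + y) = uang z x + uang z y.
Proof. by rewrite -[x]scale1r uang_linearr !scale1r. Qed.

Lemma uang0l x : uang 0 x = 0.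
Proof. by apply: (addrI (uang 0 x)); rewrite -uangDl !addr0. Qed.

Lemma uang0r x : uang x 0 = 0.
Proof. by apply: (addrI (uang x 0)); rewrite -uangDr !addr0. Qed.

Lemma uangC x y : uang x y = - uang y x.
Proof.
apply/eqP; rewrite -addr_eq0; have := uang_alt (x + y).
by rewrite uangDl !uangDr !uang_alt add0r addr0 => ->.
Qed.

Lemma uangNr x y : uang x (- y) = - uang x y.
Proof. by apply/eqP; rewrite -addr_eq0 -uangDr addNr uang0r. Qed.

(** The defining relation of [uce], solved for one term; the vanishing and exchange formulas for
    root vectors come from it. *)
Lemma uang_liel x y z : uang (lie x y) z = uang x (lie y z) + uang y (lie z x).
Proof.
rewrite [LHS]uangC; apply/esym/eqP; rewrite -subr_eq0 opprK.
rewrite /uang -!(linearD (qpi (@uce_rel k L))); apply/eqP; apply: qpi_eq0.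
by exists x, y, z.
Qed.

End LieAlgebraTheory.

(** * Commutation relations of the root vectors in [TKK D] *)

Section Brackets.
Variables (k : comPzRingType) (D : algType k).
Implicit Types (a b c : D) (i j l : 'I_3).

Lemma E1_is_linear j : linear (E1 j : D -> Vp D).
Proof.
move=> a b c; apply/matrixP => r s; rewrite !mxE.
by case: (s == j); rewrite ?scaler0 ?addr0.
Qed.

Lemma Em1_is_linear j : linear (Em1 j : D -> Vm D).
Proof.
move=> a b c; apply/matrixP => r s; rewrite !mxE.
by case: (r == j); rewrite ?scaler0 ?addr0.
Qed.

Lemma E10 j : E1 j 0 = 0 :> Vp D.
Proof. exact: linear_fun0 (E1_is_linear j). Qed.

Lemma Em10 j : Em1 j 0 = 0 :> Vm D.
Proof. exact: linear_fun0 (Em1_is_linear j). Qed.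

Lemma E1mul i j a b : kmul (E1 i a) (Em1 j b) = (if i == j then a * b else 0)%:M.
Proof.
apply/matrixP => r s; rewrite !ord1 !mxE (bigD1 i) //= !mxE eqxx big1 => [|l li].
  by rewrite addr0; case: eqP => //; rewrite mulr0.
by rewrite !mxE (negPf li) mul0r.
Qed.

Lemma E1mul0 i j a b : i != j -> kmul (E1 i a) (Em1 j b) = 0.
Proof. by move=> ij; rewrite E1mul (negPf ij) -scalemx1 scale0r. Qed.

Lemma jtriple_E1 i j l a b c :
  jtriple (E1 i a) (Em1 j b) (E1 l c) =
  E1 l (if i == j then a * b * c else 0) + E1 i (if l == j then c * b * a else 0).
Proof.
rewrite /jtriple !E1mul /kmul; congr (_ + _); apply/matrixP => r s;
  by rewrite !ord1 mul_scalar_mx !mxE; do 2!case: ifP => _; rewrite ?mulr0 ?mul0r.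
Qed.

Lemma jtriple_Em1 i j l a b c :
  jtriple (Em1 i a) (E1 j b) (Em1 l c) =
  Em1 i (if j == l then a * b * c else 0) + Em1 l (if j == i then c * b * a else 0).
Proof.
rewrite /jtriple -!kmulA !E1mul /kmul; congr (_ + _); apply/matrixP => r s;
  rewrite !ord1 !mxE big_ord1 !mxE mulr1n;
  by do 2!case: ifP => _; rewrite ?mulrA ?mulr0 ?mul0r.
Qed.

Lemma Eij_0l j a : Eij ord0 (lift ord0 j) a = (E1 j a, 0, 0).
Proof. by rewrite /Eij unlift_none liftK. Qed.

Lemma Eij_l0 i a : Eij (lift ord0 i) ord0 a = (0, 0, Em1 i a).
Proof. by rewrite /Eij unlift_none liftK. Qed.

Lemma Eij_ll i j a :
  Eij (lift ord0 i) (lift ord0 j) a = (0, - ider_delta (E1 j a) (Em1 i 1), 0).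
Proof. by rewrite /Eij !liftK. Qed.

Definition EijE := (Eij_0l, Eij_l0, Eij_ll).

Lemma Eij_is_linear (i j : 'I_4) : i != j -> linear (Eij i j : D -> TKK D).
Proof.
move=> ij a b c; case: (unliftP ord0 i) ij => [i'|] ->; case: (unliftP ord0 j) => [j'|] -> // _.
- rewrite !EijE (E1_is_linear j') ider_delta_linearl opprD -scalerN.
  by congr (_, _, _); rewrite /= ?scaler0 addr0.
- by rewrite !EijE (Em1_is_linear i'); congr (_, _, _); rewrite /= scaler0 addr0.
- by rewrite !EijE (E1_is_linear j'); congr (_, _, _); rewrite /= scaler0 addr0.
Qed.

(** Row times column is 0 here because the indices differ, so only column times row acts, and that
    is a single matrix entry [b * a]. This brings brackets into the normalized form chosen in
    [Eij]. *)
Lemma ider_delta_E i j a b : i != j ->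
  ider_delta (E1 j a) (Em1 i b) = ider_delta (E1 j (b * a)) (Em1 i 1).
Proof.
move=> ij; rewrite eq_sym in ij.
apply: ider_ext => z; rewrite ?actp_delta ?actm_delta; last congr (- _).
  rewrite /jtriple !E1mul0 // /kmul !mul0mx !add0r.
  apply/matrixP => r s; rewrite ord1 -!mulmxA !mxE; apply: eq_bigr => l _.
  by rewrite !mxE !big_ord1 !mxE; do 2!case: ifP; rewrite ?mulr0 ?mul0r ?mul1r ?mulrA.
rewrite /jtriple -(kmulA z) -(kmulA z) !E1mul0 // /kmul !mulmx0 !addr0.
apply/matrixP => r s; rewrite ord1 !mxE; apply: eq_bigr => l _.
by rewrite !mxE !big_ord1 !mxE; do 2!case: ifP; rewrite ?mulr0 ?mul0r ?mul1r ?mulrA.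
Qed.

Lemma ider_delta0l (y : Vm D) : ider_delta 0 y = 0.
Proof. by rewrite -[X in ider_delta X _](subrr 0) ider_deltaBl subrr. Qed.

Lemma ider_delta0r (x : Vp D) : ider_delta x 0 = 0.
Proof. by rewrite -[X in ider_delta _ X](subrr 0) ider_deltaBr subrr. Qed.

Lemma ider_comm0r (T : ider D) : ider_comm T 0 = 0.
Proof. by rewrite -[X in ider_comm _ X](subrr 0) ider_commBr subrr. Qed.

Lemma ider_comm0l (T : ider D) : ider_comm 0 T = 0.
Proof. by rewrite ider_commN ider_comm0r oppr0. Qed.

Lemma ider_commNr (T S : ider D) : ider_comm T (- S) = - ider_comm T S.
Proof. by rewrite -[X in ider_comm _ X]sub0r ider_commBr ider_comm0r sub0r. Qed.

Lemma ider_commNN (T S : ider D) : ider_comm (- T) (- S) = ider_comm T S.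
Proof. by rewrite ider_commNr -ider_commN ider_commNr -ider_commN. Qed.

Lemma actp0l (z : Vp D) : actp 0 z = 0. Proof. by []. Qed.
Lemma actm0l (z : Vm D) : actm 0 z = 0. Proof. by []. Qed.
Lemma actpN (T : ider D) (z : Vp D) : actp (- T) z = - actp T z. Proof. by []. Qed.
Lemma actmN (T : ider D) (z : Vm D) : actm (- T) z = - actm T z. Proof. by []. Qed.
Lemma actp0r (T : ider D) : actp T 0 = 0. Proof. exact: (raddf0 (actp T)). Qed.
Lemma actm0r (T : ider D) : actm T 0 = 0. Proof. exact: (raddf0 (actm T)). Qed.

Definition tkk_simp := (ider_delta0l, ider_delta0r, ider_comm0l, ider_comm0r,
  (actp0l, actm0l, actp0r, actm0r), ider_commNN, ider_comm_delta, actpN, actmN,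
  actp_delta, actm_delta, (@subr0, @sub0r, @addr0, @add0r, @oppr0, @opprK)).

Lemma lie_EijM (i j l : 'I_4) a b : i != j -> j != l -> i != l ->
  lie (Eij i j a) (Eij j l b) = Eij i l (a * b).
Proof.
case: (unliftP ord0 i) => [i'|] ->; case: (unliftP ord0 j) => [j'|] ->;
  case: (unliftP ord0 l) => [l'|] -> //; rewrite ?(inj_eq (@lift_inj _ _)) => ij jl il;
  rewrite !EijE /lie /= !tkk_simp.
- rewrite jtriple_E1 jtriple_Em1 eqxx (eq_sym l') (eq_sym j') (negPf il) (negPf ij).
  rewrite !E10 !Em10 !tkk_simp !mulr1 mul1r -{1}sub0r ider_deltaBr !tkk_simp.
  by rewrite ider_delta_E.
- by rewrite jtriple_Em1 eqxx (eq_sym j') (negPf ij) mul1r Em10 !tkk_simp.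
- by rewrite ider_delta_E.
- by rewrite jtriple_E1 eqxx eq_sym (negPf jl) E10 mulr1 !tkk_simp.
Qed.

Lemma lie_Eij0 (i j p q : 'I_4) a b : i != j -> p != q -> i != q -> j != p ->
  lie (Eij i j a) (Eij p q b) = 0 :> TKK D.
Proof.
case: (unliftP ord0 i) => [i'|] ->; case: (unliftP ord0 j) => [j'|] ->;
  case: (unliftP ord0 p) => [p'|] ->; case: (unliftP ord0 q) => [q'|] -> //;
  rewrite ?(inj_eq (@lift_inj _ _)) => ij pq iq jp; rewrite !EijE /lie /= !tkk_simp //.
- rewrite jtriple_E1 jtriple_Em1 (eq_sym j' i') (eq_sym q' i') (negPf ij) (negPf iq) (negPf jp).
  by rewrite !E10 !Em10 !tkk_simp.
- by rewrite jtriple_Em1 (eq_sym j' i') (negPf jp) (negPf ij) !Em10 !tkk_simp.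
- by rewrite jtriple_E1 (eq_sym j' i') (eq_sym q' i') (negPf ij) (negPf iq) !E10 !tkk_simp.
- by rewrite jtriple_Em1 (eq_sym q' i') (negPf iq) (eq_sym q' p') (negPf pq) !Em10 !tkk_simp.
- by rewrite jtriple_E1 (eq_sym q' p') (negPf pq) (negPf jp) !E10 !tkk_simp.
Qed.

End Brackets.

(** * Reduction to matrices over [D2] and the minor cocycle *)

Section Cocycle.
Variables (k : comPzRingType) (D : algType k).
Implicit Types (X Y Z : TKK D) (T : ider D).

Lemma ider_ind (P : ider D -> Prop) :
  P 0 -> (forall a T S, P T -> P S -> P (a *: T + S)) ->
  (forall x y, P (ider_delta x y)) -> forall T, P T.
Proof.
move=> P0 PL Pd T.
suff [S /val_inj <-]: exists2 S, spanval S = spanval T & P S by [].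
elim/kspan_ind_lin: (iderP T) => [|a _ _ [S1 <- P1] [S2 <- P2]|_ [x [y ->]]].
- by exists 0.
- by exists (a *: S1 + S2) => //; apply: PL.
- by exists (ider_delta x y).
Qed.

(* Modulo the ideal defining [D2], the inner derivation [T] acts on the columns
   of V^- as left multiplication by this matrix. *)
Definition derent T (i j : 'I_3) : D2 D := D2bar ((actm T (Em1 j 1) : 'cV[D]_3) i 0).

Definition bilent (x : Vp D) (y : Vm D) : D2 D :=
  \sum_l D2bar ((x : 'rV_3) 0 l) * D2bar ((y : 'cV_3) l 0).

Lemma actm_linE a T S (w : Vm D) i : (actm (a *: T + S) w : 'cV[D]_3) i 0 =
  a *: (actm T w : 'cV[D]_3) i 0 + (actm S w : 'cV[D]_3) i 0.
Proof. by rewrite actmP !mxE. Qed.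

Lemma actp_linE a T S (z : Vp D) i : (actp (a *: T + S) z : 'rV[D]_3) 0 i =
  a *: (actp T z : 'rV[D]_3) 0 i + (actp S z : 'rV[D]_3) 0 i.
Proof. by rewrite actpP !mxE. Qed.

Lemma derent_lin a T S i j : derent (a *: T + S) i j = a *: derent T i j + derent S i j.
Proof. by rewrite /derent actm_linE linearP. Qed.

Lemma derent0 i j : derent 0 i j = 0.
Proof. by rewrite /derent actm0l mxE linear0. Qed.

Lemma kmul_bilent x y : D2bar ((kmul x y : 'M[D]_1) 0 0) = bilent x y.
Proof. by rewrite mxE linear_sum; apply: eq_bigr => l _; rewrite /= D2barM. Qed.

Lemma actm_delta_bar x y (w : Vm D) i :
  D2bar ((actm (ider_delta x y) w : 'cV[D]_3) i 0) =
  D2bar ((y : 'cV_3) i 0) * bilent x w + D2bar ((w : 'cV_3) i 0) * bilent x y.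
Proof.
rewrite actm_delta /jtriple -!kmulA mxE linearN /= D2_opp mxE linearD /=.
by rewrite !mxE !big_ord1 !D2barM !kmul_bilent.
Qed.

Lemma actp_delta_bar x y (z : Vp D) j :
  D2bar ((actp (ider_delta x y) z : 'rV[D]_3) 0 j) =
  bilent x y * D2bar ((z : 'rV_3) 0 j) + bilent z y * D2bar ((x : 'rV_3) 0 j).
Proof.
rewrite actp_delta /jtriple mxE linearD /=.
by rewrite ![kmul (kmul _ _) _ _ _]mxE !big_ord1 !D2barM !kmul_bilent.
Qed.

Lemma bilent_Em1 x j : bilent x (Em1 j 1) = D2bar ((x : 'rV_3) 0 j).
Proof.
rewrite /bilent (bigD1 j) //= mxE eqxx mulr1 big1 ?addr0 // => l lj.
by rewrite mxE (negPf lj) linear0 mulr0.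
Qed.

Lemma derentD T S i j : derent (T + S) i j = derent T i j + derent S i j.
Proof. by rewrite -[T]scale1r derent_lin !scale1r. Qed.

Lemma derentN T i j : derent (- T) i j = derent T i j.
Proof. by rewrite -[RHS]D2_opp; apply/eqP; rewrite -addr_eq0 -derentD addNr derent0. Qed.

(** Over the commutative ring [D2] the operator sending w to yxw + wxy is left multiplication by the
    rank one matrix yx plus the scalar xy; the sign disappears in characteristic 2. *)
Lemma derent_delta x y i j : derent (ider_delta x y) i j =
  D2bar ((y : 'cV_3) i 0) * D2bar ((x : 'rV_3) 0 j) + (i == j)%:R * bilent x y.
Proof.
rewrite /derent actm_delta_bar bilent_Em1 mxE; congr (_ + _ * _).
by case: eqP; rewrite ?linear0.
Qed.

Lemma actm_derent T (w : Vm D) i : D2bar ((actm T w : 'cV[D]_3) i 0) =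
  \sum_j derent T i j * D2bar ((w : 'cV_3) j 0).
Proof.
elim/ider_ind: T => [|a T S hT hS|x y].
- by rewrite mxE linear0 big1 // => j _; rewrite derent0 mul0r.
- rewrite actm_linE linearP /= hT hS D2scaleE mulr_sumr -big_split /=.
  by apply: eq_bigr => j _; rewrite derent_lin mulrDl D2scaleE mulrA.
rewrite actm_delta_bar; under eq_bigr do rewrite derent_delta mulrDl -mulrA.
rewrite big_split /= -mulr_sumr; congr (_ + _).
rewrite (bigD1 i) //= eqxx mul1r mulrC big1 ?addr0 // => j ji.
by rewrite eq_sym (negPf ji) !mul0r.
Qed.

(** On V^+ the operator xyz + zyx is right multiplication by the same matrix yx + xy, so one matrix
    records both components of an inner derivation. *)
Lemma actp_derent T (z : Vp D) j : D2bar ((actp T z : 'rV[D]_3) 0 j) =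
  \sum_i D2bar ((z : 'rV_3) 0 i) * derent T i j.
Proof.
elim/ider_ind: T => [|a T S hT hS|x y].
- by rewrite mxE linear0 big1 // => i _; rewrite derent0 mulr0.
- rewrite actp_linE linearP /= hT hS D2scaleE mulr_sumr -big_split /=.
  by apply: eq_bigr => i _; rewrite derent_lin mulrDr D2scaleE mulrCA.
rewrite actp_delta_bar; under eq_bigr do rewrite derent_delta mulrDr mulrA.
rewrite big_split /= -mulr_suml addrC; congr (_ + _).
rewrite (bigD1 j) //= eqxx mul1r mulrC big1 ?addr0 // => i ij.
by rewrite (negPf ij) mul0r mulr0.
Qed.

(** On a generator, yx has trace xy and the 3 x 3 scalar part contributes 3xy, in total 4xy = 0. *)
Lemma derent_trace T : \sum_i derent T i i = 0.
Proof.
elim/ider_ind: T => [|a T S hT hS|x y].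
- by rewrite big1 // => i _; rewrite derent0.
- under eq_bigr do rewrite derent_lin.
  by rewrite big_split /= -scaler_sumr hT hS scaler0 addr0.
under eq_bigr do rewrite derent_delta eqxx mul1r mulrC.
rewrite big_split /= sumr_const card_ord /= -/(bilent x y) -mulrS.
by rewrite (mulrnA _ 2 2) mulr2n D2_char2.
Qed.

Lemma derent_comm T S i j : derent (ider_comm T S) i j =
  \sum_l (derent T i l * derent S l j + derent S i l * derent T l j).
Proof.
rewrite big_split /= {1}/derent actm_comm 2!mxE linearB /= !actm_derent.
by rewrite D2_opp.
Qed.

(* The entries of the image of [X] in 4 x 4 matrices over D2, normalized by a
   scalar matrix so that the entry (1, 1) is 0. *)
Definition tkkmx X (i j : 'I_4) : D2 D :=
  let: (x, T, y) := X in
  match unlift ord0 i, unlift ord0 j with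
  | None, None => 0
  | None, Some j' => D2bar ((x : 'rV_3) 0 j')
  | Some i', None => D2bar ((y : 'cV_3) i' 0)
  | Some i', Some j' => derent T i' j'
  end.

Lemma tkkmx_lin a X Y i j : tkkmx (a *: X + Y) i j = a *: tkkmx X i j + tkkmx Y i j.
Proof.
case: X Y => [[x T] y] [[x' T'] y']; rewrite /tkkmx /=.
case: (unlift ord0 i) (unlift ord0 j) => [i'|] [j'|]; rewrite ?scaler0 ?addr0 //.
- exact: derent_lin.
- by rewrite !mxE linearP.
- by rewrite !mxE linearP.
Qed.

Lemma tkkmx_trace X : \sum_i tkkmx X i i = 0.
Proof.
case: X => [[x T] y]; rewrite big_ord_recl /tkkmx unlift_none add0r.
by under eq_bigr do rewrite liftK; exact: derent_trace.
Qed.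

(** Off the diagonal this is the matrix commutator, written with plus signs. On the diagonal the two
    sides differ by the scalar that normalizes the entry (1, 1). *)
Lemma tkkmx_lie X Y i j : i != j -> tkkmx (lie X Y) i j =
  \sum_l (tkkmx X i l * tkkmx Y l j + tkkmx Y i l * tkkmx X l j).
Proof.
case: X Y => [[x T] y] [[x' T'] y'] ij; rewrite big_ord_recl /tkkmx /lie /= unlift_none.
under eq_bigr do rewrite liftK.
case: (unliftP ord0 i) ij => [i'|] ->; case: (unliftP ord0 j) => [j'|] -> // ij.
- rewrite (inj_eq (@lift_inj _ _)) in ij.
  rewrite /= !derentD derentN derent_comm !derent_delta (negPf ij) !mul0r !addr0.
  ring.
- rewrite 2!mxE linearB /= !actm_derent D2_opp !mulr0 !add0r.
  by rewrite big_split.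
- rewrite 2!mxE linearB /= !actp_derent D2_opp !mul0r !add0r.
  rewrite big_split /= addrC; congr (_ + _).
Qed.

Lemma tkkmx_Eij (i j r s : 'I_4) (a : D) : i != j -> r != s ->
  tkkmx (Eij i j a) r s = if (r == i) && (s == j) then D2bar a else 0.
Proof.
case: (unliftP ord0 i) => [i'|] ->; case: (unliftP ord0 j) => [j'|] -> // ij;
case: (unliftP ord0 r) => [r'|] ->; case: (unliftP ord0 s) => [s'|] -> // rs;
rewrite EijE /tkkmx ?liftK ?unlift_none ?(inj_eq (@lift_inj _ _)) /=.
- rewrite (inj_eq (@lift_inj _ _)) in rs.
  rewrite derentN derent_delta !mxE (negPf rs) mul0r addr0 -D2barM.
  by case: (r' == i'); case: (s' == j'); rewrite ?mul0r ?mulr0 ?mul1r ?linear0.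
all: rewrite ?derent0 ?andbF ?andbT ?mxE ?linear0 //.
all: by case: ifP => // _; rewrite linear0.
Qed.

Section TwoByTwoMinor.
Variables (i j p q : 'I_4).
Hypothesis u : uniq [:: i; j; p; q].

(* The polarization of the minor with rows i, p and columns j, q: in
   characteristic 2 it is an alternating cocycle on trace zero matrices. *)
Definition minor_form X Y : D2 D :=
  tkkmx X i j * tkkmx Y p q + tkkmx X p q * tkkmx Y i j +
  (tkkmx X i q * tkkmx Y p j + tkkmx X p j * tkkmx Y i q).

Lemma minor_form_linl a X Y Z :
  minor_form (a *: X + Y) Z = a *: minor_form X Z + minor_form Y Z.
Proof. rewrite /minor_form !tkkmx_lin !D2scaleE; ring. Qed.

Lemma minor_formC X Y : minor_form X Y = minor_form Y X.
Proof. rewrite /minor_form; ring. Qed.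

Lemma minor_form_linr a X Y Z :
  minor_form Z (a *: X + Y) = a *: minor_form Z X + minor_form Z Y.
Proof. by rewrite !(minor_formC Z) minor_form_linl. Qed.

Lemma minor_form_alt X : minor_form X X = 0.
Proof.
rewrite /minor_form [X in X + _ + _]mulrC D2_char2 add0r.
by rewrite [X in X + _]mulrC D2_char2.
Qed.

Lemma sum_uniq4 (F : 'I_4 -> D2 D) : \sum_l F l = F i + F j + F p + F q.
Proof.
rewrite (eq_bigl [in [:: i; j; p; q]]) => [|l]; last exact/esym/(mem_uniq4 l u).
by rewrite -big_uniq //= !big_cons big_nil addr0 !addrA.
Qed.

Lemma minor_form_cocycle X Y Z :
  minor_form X (lie Y Z) + minor_form Y (lie Z X) + minor_form Z (lie X Y) = 0.
Proof.
have [[ij pq iq pj] _] := uniq4P u.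
rewrite /minor_form !(@tkkmx_lie _ _ i j, @tkkmx_lie _ _ p q, @tkkmx_lie _ _ i q,
  @tkkmx_lie _ _ p j) //.
rewrite !sum_uniq4.
have := tkkmx_trace X; have := tkkmx_trace Y; have := tkkmx_trace Z.
rewrite !sum_uniq4.
move: (tkkmx X) (tkkmx Y) (tkkmx Z) => x y z trz try trx.
pose M := 'I_4 -> 'I_4 -> D2 D.
pose f (u v w : M) := u i j * v p q + u p q * v i j + (u i q * v p j + u p j * v i q).
(* The monomials without a diagonal entry come in equal pairs; the others
   assemble into the three traces. *)
pose g (u v w : M) := u i j * v p i * w i q + u i q * v p i * w i j
  + u p j * v i p * w p q + u p q * v i p * w p j.
pose h (u v w : M) := u i j * v p j * w j q + u i q * v p q * w q j
  + u p j * v i j * w j q + u p q * v i q * w q j.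
(* The intermediate index of the matrix products is a row index, [i] or [p], in [g] and a column
   index, [j] or [q], in [h]. *)
pose Q := g x y z + g y z x + g z x y + (h x y z + h y z x + h z x y).
transitivity (Q + Q + ((x i i + x j j + x p p + x q q) * f y z x +
  (y i i + y j j + y p p + y q q) * f z x y + (z i i + z j j + z p p + z q q) * f x y z)).
  rewrite /Q /f /g /h; ring.
by rewrite trx try trz !mul0r !addr0 D2_char2.
Qed.

(** As [uce] is a quotient of a quotient of a free module, the form descends in three stages, in
    parallel with [umap]. *)
Definition minor_free := flift (fun P : TKK D * TKK D => minor_form P.1 P.2).
HB.instance Definition _ := GRing.Linear.on minor_free.

Lemma minor_free_rel r : ext_rel r -> minor_free r = 0.
Proof.
move=> [[a [x [y [z ->]]]]|[[a [x [y [z ->]]]]|[x ->]]].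
- by rewrite /minor_free linearB linearP /= !flift_gen /= minor_form_linl subrr.
- by rewrite /minor_free linearB linearP /= !flift_gen /= minor_form_linr subrr.
- by rewrite /minor_free flift_gen minor_form_alt.
Qed.

Definition minor_ext : extsq (TKK D) -> D2 D := qlift minor_free.
HB.instance Definition _ :=
  GRing.isLinear.Build k (extsq (TKK D)) (D2 D) *:%R minor_ext (qlift_linear minor_free_rel).

Lemma minor_ext_wedge X Y : minor_ext (wedge X Y) = minor_form X Y.
Proof. by rewrite /minor_ext qlift_pi; [exact: flift_gen | exact: minor_free_rel]. Qed.

Lemma minor_ext_rel w : uce_rel w -> minor_ext w = 0.
Proof.
by move=> [X [Y [Z ->]]]; rewrite !linearD /= !minor_ext_wedge minor_form_cocycle.
Qed.

Definition minor_uce : uce (TKK D) -> D2 D := qlift minor_ext.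
HB.instance Definition _ :=
  GRing.isLinear.Build k (uce (TKK D)) (D2 D) *:%R minor_uce (qlift_linear minor_ext_rel).

(* Unlike [minor_uce], this carries the proofs that the indices are distinct, so
   that its linearity can be inferred. *)
Definition minor_map : {linear uce (TKK D) -> D2 D} := minor_uce.

Lemma minor_mapE X Y : minor_map (uang X Y) = minor_form X Y.
Proof. by rewrite /= /minor_uce qlift_pi; [exact: minor_ext_wedge | exact: minor_ext_rel]. Qed.

Lemma minor_map_Eij a b : minor_map (uang (Eij i j a) (Eij p q b)) = D2bar (a * b).
Proof.
have [[ij pq iq pj] [ip jq _]] := uniq4P u.
rewrite minor_mapE /minor_form !tkkmx_Eij // !eqxx (negPf ip) (eq_sym p i) (negPf ip).
by rewrite (eq_sym q j) (negPf jq) !mul0r !addr0 D2barM.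
Qed.

End TwoByTwoMinor.

End Cocycle.

(** * Roots of [A3] and their degenerate sums *)

Section Roots.
Implicit Types (i j p q l : 'I_4).

Lemma epsE i j l : eps i j 0 l = (l == i)%:R - (l == j)%:R.
Proof. by rewrite !mxE eqxx. Qed.

Lemma eps_diag i : eps i i = 0.
Proof. exact: subrr. Qed.

(** The left side has coordinate 1 at [i] and -1 at [j], which locates [p] and [q]. *)
Lemma eps_inj i j p q : i != j -> eps i j = eps p q -> i = p /\ j = q.
Proof.
move=> ij e; have h l : eps i j 0 l = eps p q 0 l by rewrite e.
move: (h i) (h j); rewrite !epsE !eqxx (eq_sym j) (negPf ij).
by do 4![case: eqP => //].
Qed.

Lemma A3_eps i j : A3 (eps i j).
Proof. by exists i, j. Qed.

Lemma eps_trans i j l : eps i j + eps j l = eps i l.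
Proof. by rewrite /eps addrA subrK. Qed.

Lemma dot_epsE v p q : dot v (eps p q) = v 0 p - v 0 q.
Proof.
rewrite /dot; under eq_bigr do rewrite epsE mulrBr.
rewrite sumrB (bigD1 p) //= eqxx mulr1 big1 ?addr0 => [|l /negPf ->]; last exact: mulr0.
by rewrite (bigD1 q) //= eqxx mulr1 big1 ?addr0 => [|l /negPf ->]; last exact: mulr0.
Qed.

Lemma coroot_pairing_eps v p q : p != q -> coroot_pairing v (eps p q) = v 0 p - v 0 q.
Proof.
move=> pq; rewrite /coroot_pairing !dot_epsE !epsE !eqxx (eq_sym q) (negPf pq).
by rewrite mulrC mulzK.
Qed.

Lemma coroot_pairing0 v : coroot_pairing v 0 = 0.
Proof. by rewrite -(eps_diag 0) /coroot_pairing dot_epsE subrr mulr0 div0z. Qed.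

(** All coordinates of the sum are 1 or -1, so each pairing with a coroot, a difference of two
    coordinates or 0, is even. *)
Lemma degenerate_eps i j p q : uniq [:: i; j; p; q] -> degenerate_sum (eps i j) (eps p q).
Proof.
move=> u; have [[ij pq iq _] [ip jq jp]] := uniq4P u.
split; [exact: A3_eps | exact: A3_eps | |].
  move=> a b ab0; have h l : a * eps i j 0 l + b * eps p q 0 l = 0.
    by have /rowP/(_ l) := ab0; rewrite !mxE.
  move: (h i) (h p); rewrite !epsE !eqxx (eq_sym p i) (eq_sym p j).
  rewrite (negPf ij) (negPf ip) (negPf iq) (negPf jp) (negPf pq).
  by rewrite !subr0 !mulr0 !mulr1 addr0 add0r.
exists 2%N; split=> // _ [s [t ->]].
have [->|st] := eqVneq s t; first by rewrite eps_diag coroot_pairing0.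
rewrite coroot_pairing_eps //.
have odd l : exists z : int, (eps i j + eps p q) 0 l = 2 * z + 1.
  rewrite mxE !epsE.
  have := mem_uniq4 l u.
  rewrite !inE => /or4P[] /eqP ->; rewrite !eqxx.
  - by rewrite (negPf ij) (negPf ip) (negPf iq); exists 0.
  - by rewrite (eq_sym j i) (negPf ij) (negPf jp) (negPf jq); exists (-1).
  - by rewrite (eq_sym p i) (eq_sym p j) (negPf ip) (negPf jp) (negPf pq); exists 0.
  - by rewrite (eq_sym q i) (eq_sym q j) (eq_sym q p) (negPf iq) (negPf jq) (negPf pq); exists (-1).
have [[x ->] [y ->]] := (odd s, odd t).
by rewrite (_ : _ - _ = 2 * (x - y)) ?dvdz_mulr //; ring.
Qed.

Lemma degenerate_epsP alpha beta : degenerate_sum alpha beta ->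
  exists i j p q, [/\ uniq [:: i; j; p; q], alpha = eps i j & beta = eps p q].
Proof.
move=> [[i [j ->]] [p [q ->]] ind [d [d1 dvd]]]; exists i, j, p, q; split=> //.
have ij : i != j.
  apply/eqP => ij; have [|//] := ind 1 0.
  by rewrite ij eps_diag scaler0 scale0r addr0.
have pq : p != q.
  apply/eqP => pq; have [|//] := ind 0 1.
  by rewrite pq eps_diag scaler0 scale0r addr0.
have vE l : (eps i j + eps p q) 0 l = (l == i)%:R - (l == j)%:R + ((l == p)%:R - (l == q)%:R).
  by rewrite mxE !epsE.
(* Unless the four indices are distinct, two entries of the sum differ by 1. *)
have no1 (s t : 'I_4) : (eps i j + eps p q) 0 s - (eps i j + eps p q) 0 t != 1.
  apply/eqP => e; have st : s != t by apply/eqP => st; move: e; rewrite st subrr.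
  have := dvd _ (A3_eps s t); rewrite coroot_pairing_eps // e dvdz1 absz_nat => /eqP d_1.
  by rewrite d_1 in d1.
(* In each case [m] has coordinate 0 and is compared with a coordinate 1 or -1. Opposite or equal
   roots are excluded by linear independence. *)
have iq : i != q.
  apply/eqP => iq; have [m [mi mj mp]] := ord4_avoid i j p.
  have pj : p != j.
    apply/eqP => pj; have [|//] := ind 1 1.
    by rewrite !scale1r pj -iq eps_trans eps_diag.
  move: (no1 p m); rewrite !vE -iq (negPf mi) (negPf mj) (negPf mp) eqxx (negPf pj).
  by case: (p == i).
have jp : j != p.
  apply/eqP => jp; have [m [mi mj mq]] := ord4_avoid i j q.
  move: (no1 i m); rewrite !vE -jp (negPf mi) (negPf mj) (negPf mq) eqxx (negPf iq).
  by case: (i == j).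
have ip : i != p.
  apply/eqP => ip; have [m [mi mj mq]] := ord4_avoid i j q.
  have jq : j != q.
    apply/eqP => jq; have [|//] := ind 1 (-1).
    by rewrite -ip -jq scaleN1r scale1r subrr.
  move: (no1 m j); rewrite !vE -ip (negPf mi) (negPf mj) (negPf mq) eqxx (eq_sym j i).
  by rewrite (negPf ij) (negPf jq).
have jq : j != q.
  apply/eqP => jq; have [m [mi mj mp]] := ord4_avoid i j p.
  move: (no1 i m); rewrite !vE -jq (negPf mi) (negPf mj) (negPf mp) eqxx.
  by rewrite (negPf ij) (negPf ip).
by rewrite /= !inE !negb_or ij ip iq jp jq pq.
Qed.

(** A coordinate 1 can only come from [r] or [s], a coordinate -1 only from [c] or [t]. Up to order
    this leaves two decompositions of a degenerate sum. *)
Lemma eps_sum_decomp i j p q r c s t : uniq [:: i; j; p; q] ->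
  eps i j + eps p q = eps r c + eps s t ->
  ((r = i /\ s = p) \/ (r = p /\ s = i)) /\ ((c = j /\ t = q) \/ (c = q /\ t = j)).
Proof.
move=> /uniq4P[[ij pq iq _] [ip jq jp]] e.
have h l : eps i j 0 l + eps p q 0 l = eps r c 0 l + eps s t 0 l.
  by have := congr1 (fun v : 'rV_4 => v 0 l) e; rewrite !mxE.
move: (h i) (h p) (h j) (h q) => {e h}; rewrite !epsE !eqxx.
rewrite (eq_sym p i) (eq_sym p j) (eq_sym j i) (eq_sym q i) (eq_sym q j) (eq_sym q p).
rewrite (negPf ij) (negPf ip) (negPf iq) (negPf jp) (negPf jq) (negPf pq).
move=> hi hp hj hq.
have rs : (r = i \/ s = i) /\ (r = p \/ s = p).
  split.
  - move: hi; case: (i =P r) => [->|_]; first by left.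
    by case: (i =P s) => [->|_]; [right|case: (i == c); case: (i == t)].
  - move: hp; case: (p =P r) => [->|_]; first by left.
    by case: (p =P s) => [->|_]; [right|case: (p == c); case: (p == t)].
have ct : (c = j \/ t = j) /\ (c = q \/ t = q).
  split.
  - move: hj; case: (j =P c) => [->|_]; first by left.
    by case: (j =P t) => [->|_]; [right|case: (j == r); case: (j == s)].
  - move: hq; case: (q =P c) => [->|_]; first by left.
    by case: (q =P t) => [->|_]; [right|case: (q == r); case: (q == s)].
move/eqP: ip => ip; move/eqP: jq => jq.
have := rs; have := ct; intuition congruence.
Qed.
End Roots.

(** * The component of degenerate degree and its isomorphism with [D2] *)

Section DegenerateComponent.
Variables (k : comPzRingType) (D : algType k).
Implicit Types (a b c : D) (i j p q : 'I_4).

Lemma lie_EijN (i j l : 'I_4) a b : i != j -> j != l -> i != l ->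
  lie (Eij j l a) (Eij i j b) = - Eij i l (b * a) :> TKK D.
Proof. by move=> ij jl il; rewrite lieN lie_EijM. Qed.

(** After the expansion through [m], both inner brackets vanish: [m] avoids [q], so [Eij m j 1]
    commutes with [Eij i q b], and two root vectors of row [i] commute. *)
Lemma uang_Eij_row i j q a b : i != j -> i != q -> uang (Eij i j a) (Eij i q b) = 0 :> uce (TKK D).
Proof.
move=> ij iq; have [m [mi mj mq]] := ord4_avoid i j q.
have im : i != m by rewrite eq_sym.
rewrite -[a]mulr1 -(lie_EijM a 1 im mj ij) uang_liel.
by rewrite !lie_Eij0 ?uang0r ?addr0 // eq_sym.
Qed.

Lemma uang_Eij_col i j p a b : i != j -> p != j -> uang (Eij i j a) (Eij p j b) = 0 :> uce (TKK D).
Proof.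
move=> ij pj; have [m [mi mj mp]] := ord4_avoid i j p.
have im : i != m by rewrite eq_sym.
rewrite -[a]mulr1 -(lie_EijM a 1 im mj ij) uang_liel.
by rewrite !lie_Eij0 ?uang0r ?addr0 // eq_sym.
Qed.

Section Distinct.
Variables (i j p q : 'I_4).
Hypothesis u : uniq [:: i; j; p; q].

(* Expand E_ij(ab) as [E_ip(a), E_pj(b)]. *)
Lemma uang_Eij_swap a b c : uang (Eij i j (a * b)) (Eij p q c) =
  uang (Eij i q (a * c)) (Eij p j b) :> uce (TKK D).
Proof.
have [[ij pq iq pj] [ip jq jp]] := uniq4P u.
rewrite -(lie_EijM a b ip pj ij) uang_liel lie_Eij0 ?uang0r ?add0r //.
by rewrite lie_EijN // uangNr -uangC.
Qed.

(* Expand E_ij(ab) as [E_iq(a), E_qj(b)]. *)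
Lemma uang_Eij_swapN a b c : uang (Eij i j (a * b)) (Eij p q c) =
  - uang (Eij i q a) (Eij p j (c * b)) :> uce (TKK D).
Proof.
have [[ij pq iq pj] [ip jq jp]] := uniq4P u.
have qj : q != j by rewrite eq_sym.
rewrite -(lie_EijM a b iq qj ij) uang_liel lie_EijN // ?uangNr.
by rewrite lie_Eij0 ?uang0r ?addr0 // eq_sym.
Qed.

End Distinct.

Lemma uniq_swap i j p q : uniq [:: i; j; p; q] -> uniq [:: i; q; p; j].
Proof.
rewrite /= !inE !negb_or => /and4P[/and3P[-> -> ->] /andP[jp jq] pq _].
by rewrite (eq_sym q) pq (eq_sym q) jq eq_sym jp.
Qed.

Section Distinct.
Variables (i j p q : 'I_4).
Hypothesis u : uniq [:: i; j; p; q].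
Let w := uniq_swap u.

(** This is the map h of the introductory sketch. *)
Definition degang a : uce (TKK D) := uang (Eij i j a) (Eij p q 1).

Lemma uang_crossE a b : uang (Eij i q a) (Eij p j b) = degang (a * b).
Proof. by rewrite -[X in Eij i q X]mulr1 (uang_Eij_swap w). Qed.

Lemma uang_degang a b : uang (Eij i j a) (Eij p q b) = degang (a * b).
Proof. by rewrite -[X in Eij i j X]mulr1 (uang_Eij_swap u) uang_crossE mulr1. Qed.

(** The two expansions of [Eij i j a] lead to the same cross bracket with opposite signs. *)
Lemma degangN a : degang a = - degang a.
Proof.
by rewrite {1}/degang -[X in Eij i j X]mulr1 (uang_Eij_swapN u) uang_crossE !mulr1.
Qed.

(** Both sides evaluate the bracket of [Eij i j (a * b)] and [Eij p q c], directly and after the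
    exchange of columns. *)
Lemma degang_perm a b c : degang (a * b * c) = degang (a * c * b).
Proof. by rewrite -uang_degang (uang_Eij_swap u) uang_crossE. Qed.

Lemma degang_is_linear : linear degang.
Proof.
have [[ij _ _ _] _] := uniq4P u; move=> c a b.
by rewrite /degang (Eij_is_linear ij) uang_linearl.
Qed.
HB.instance Definition _ := GRing.isLinear.Build k D (uce (TKK D)) *:%R degang degang_is_linear.
Definition degang_map : {linear D -> uce (TKK D)} := degang.

Lemma degang_ideal z : D2_ideal_gen z -> degang z = 0.
Proof.
move=> [x [s [y [-> [[d ->]|[a [b ->]]]]]]].
  by rewrite mulrnAr mulrnAl linearMn /= mulr2n [X in X + _]degangN addNr.
rewrite mulrBr mulrBl linearB /= !mulrA.
(* Moving [y] to the front leaves [a] and [b] in the last two places, where [degang_perm] exchanges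
   them. *)
have rot v : degang (v * y) = degang (y * v).
  by rewrite -[v * y]mul1r mulrA degang_perm mul1r.
by rewrite !rot !mulrA degang_perm subrr.
Qed.

Lemma degang_gr a : kspan (uce_gr_gen (eps i j + eps p q)) (degang a).
Proof.
have [[ij pq _ _] _] := uniq4P u.
apply: kspan_incl; exists (eps i j), (Eij i j a), (Eij p q 1); split=> //.
- exact/kspan_incl/A3_eps.
- by apply: Or32; exists i, j, a.
- by rewrite addrC addKr; apply: Or32; exists p, q, 1.
Qed.

End Distinct.

(** If a factor has degree 0, or [i = q], or [j = p], then either the generator vanishes or its
    degree is in [A3]. The cases [i = p] and [j = q] give zero brackets. *)
Lemma uce_gr_gen_eps gamma X : ~ A3 gamma -> @uce_gr_gen k D gamma X ->
  X = 0 \/ exists i j p q a b, [/\ uniq [:: i; j; p; q], gamma = eps i j + eps p q &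
    X = uang (Eij i j a) (Eij p q b)].
Proof.
move=> nA [delta [x [y [_ hx hy ->]]]].
case: hx => [[d0 _]|[i [j [a [ij dE ->]]]]|->]; last by left; rewrite uang0l.
  move: hy; rewrite d0 subr0 => -[[g0 _]|[i [j [a [_ gE _]]]]|->].
  (* The degree 0 belongs to [A3], as [eps ord0 ord0]. *)
  - by case: nA; exists ord0, ord0; rewrite eps_diag.
  - by case: nA; rewrite gE; exact: A3_eps.
  - by left; rewrite uang0r.
case: hy => [[g0 _]|[p [q [b [pq gE ->]]]]|->]; last by left; rewrite uang0r.
  by case: nA; rewrite (subr0_eq g0) dE; exact: A3_eps.
have {}gE : gamma = eps i j + eps p q by rewrite -gE -dE addrC subrK.
have iq : i != q.
  by apply/eqP => iq; case: nA; rewrite gE iq addrC eps_trans; exact: A3_eps.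
have jp : j != p by apply/eqP => jp; case: nA; rewrite gE jp eps_trans; exact: A3_eps.
have [ip|ip] := eqVneq i p; first by left; rewrite -ip uang_Eij_row.
have [jq|jq] := eqVneq j q; first by left; rewrite -jq uang_Eij_col // jq.
by right; exists i, j, p, q, a, b; split=> //; rewrite /= !inE !negb_or ij ip iq jp jq pq.
Qed.

Lemma not_A3_sum i j p q : uniq [:: i; j; p; q] -> ~ A3 (eps i j + eps p q).
Proof.
move=> u [r [s e]].
have [[ij _ iq _] _] := uniq4P u.
(* Padding with [eps i i = 0] makes the root a sum of two differences; the negative index [i] of the
   padding would have to be [j] or [q]. *)
have e' : eps i j + eps p q = eps r s + eps i i by rewrite eps_diag addr0.
have [_ [[_ /eqP]|[_ /eqP]]] := eps_sum_decomp u e'.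
- by rewrite (negPf iq).
- by rewrite (negPf ij).
Qed.

(** Surjectivity: the four ordered decompositions of the degree give straight or cross brackets, and
    the sign from reversing their order is absorbed by [degangN]. *)
Lemma uce_gr_degang i j p q X : uniq [:: i; j; p; q] ->
  kspan (uce_gr_gen (eps i j + eps p q)) X -> exists a, X = degang i j p q a.
Proof.
move=> u; elim/kspan_ind_lin => [|c _ _ [a ->] [b ->]|Y].
- by exists 0; rewrite (linear_fun0 (degang_is_linear u)).
- by exists (c *: a + b); rewrite (degang_is_linear u).
move=> /(uce_gr_gen_eps (not_A3_sum u)).
case=> [->|[r [c [s [t [a [b [_ e ->]]]]]]]].
  by exists 0; rewrite (linear_fun0 (degang_is_linear u)).
have [[[-> ->]|[-> ->]] [[-> ->]|[-> ->]]] := eps_sum_decomp u e.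
- by exists (a * b); rewrite uang_degang.
- by exists (a * b); rewrite uang_crossE.
- by exists (b * a); rewrite uangC uang_crossE // -degangN.
- by exists (b * a); rewrite uangC uang_degang // -degangN.
Qed.

(** The bracket of [Eij i m a] and [Eij m j 1] is a witness, so the default 0 of [xget] does not
    occur. *)
Lemma umap_xroot i j a : i != j -> umap (xroot (eps i j) a) = Eij i j a.
Proof.
move=> ij; rewrite /xroot; case: xgetP => [X _ /= [_ [r [s [rs e ->]]]]|no].
  by have [-> ->] := eps_inj ij e.
have [m [mi mj _]] := ord4_avoid i j i; have im : i != m by rewrite eq_sym.
case: (no (uang (Eij i m a) (Eij m j 1))); split; last first.
  by exists i, j; rewrite umapE lie_EijM // mulr1.
apply: kspan_incl; exists (eps i m), (Eij i m a), (Eij m j 1); split=> //.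
- exact/kspan_incl/A3_eps.
- by apply: Or32; exists i, m, a.
- by apply: Or32; exists m, j, 1; rewrite -(eps_trans i m j) addrC addKr.
Qed.

Section Iso.
Variables (i j p q : 'I_4).
Hypothesis u : uniq [:: i; j; p; q].
Local Notation minor := (minor_map D u).

Definition uce_gr_D2 (X : uce_gr D (eps i j + eps p q)) : D2 D := minor (spanval X).

Lemma uce_gr_D2_is_linear : linear uce_gr_D2.
Proof. by move=> c X Y; rewrite /uce_gr_D2 -(linearP minor). Qed.
HB.instance Definition _ :=
  GRing.isLinear.Build k (uce_gr D (eps i j + eps p q)) (D2 D) *:%R uce_gr_D2 uce_gr_D2_is_linear.
Definition uce_gr_D2_map : {linear uce_gr D (eps i j + eps p q) -> D2 D} := uce_gr_D2.

Lemma minor_degang a : minor (degang i j p q a) = D2bar a.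
Proof. by rewrite /degang minor_map_Eij mulr1. Qed.

Lemma uce_gr_D2_bij : bijective uce_gr_D2.
Proof.
exists (fun z => inSpan (degang_gr u (repr z))) => [X|z]; last first.
  by rewrite /uce_gr_D2 /= minor_degang D2bar_reprK.
apply: val_inj => /=; rewrite /uce_gr_D2.
have [a ->] : exists a, spanval X = degang i j p q a.
  by apply: uce_gr_degang u _; case: X => X /= /inspanP.
rewrite minor_degang.
(* As [degang] factors through [D2], its value at [repr (D2bar a)] is its value at [a]. *)
exact: (qlift_pi (f := degang_map u) (degang_ideal u)).
Qed.

End Iso.
End DegenerateComponent.

Theorem theorem6p4p8 (k : comPzRingType) (D : algType k) :
  (forall gamma : 'rV[int]_4, uce_supp D gamma -> ~ A3 gamma ->
     exists alpha beta : 'rV[int]_4,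
       [/\ degenerate_sum alpha beta, gamma = alpha + beta,
           alpha != 0 /\ beta != 0, alpha != beta & ~ A3 (alpha + beta)]) /\
  (forall alpha beta : 'rV[int]_4, degenerate_sum alpha beta ->
     exists phi : {linear uce_gr D (alpha + beta) -> D2 D},
       bijective phi /\
       forall a b : D,
         exists2 X : uce_gr D (alpha + beta),
           spanval X = lie (xroot alpha a) (xroot beta b) &
           phi X = D2bar (a * b)).
Proof.
split=> [gamma [_ [X X0]] nA|alpha beta /degenerate_epsP[i [j [p [q [u -> ->]]]]]].
  (* Otherwise every generator of the component would be 0, and [X] with it. *)
  apply: contrapT => no; case/eqP: X0; apply: val_inj => /=.
  case: X => X /= /inspanP; elim/kspan_ind => [//|Y Z -> ->|c Y ->|Y].
  - exact: addr0.
  - exact: scaler0.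
  case/(uce_gr_gen_eps nA) => // -[i [j [p [q [a [b [u gE _]]]]]]].
  have [[ij pq _ _] [ip _ _]] := uniq4P u.
  case: no; exists (eps i j), (eps p q); split; rewrite -?gE //.
  - exact: degenerate_eps.
  (* Writing 0 as [eps i i] lets [eps_inj] refute it. *)
  - split; apply/eqP; rewrite -(eps_diag i) => e.
      by have [_ /eqP] := eps_inj ij e; rewrite eq_sym (negPf ij).
    by have [/eqP] := eps_inj pq e; rewrite eq_sym (negPf ip).
  - by apply/eqP => /(eps_inj ij)[/eqP]; rewrite (negPf ip).
exists (uce_gr_D2_map D u); split; first exact: uce_gr_D2_bij.
have [[ij pq _ _] _] := uniq4P u; move=> a b.
exists (inSpan (degang_gr u (a * b))) => /=; last by rewrite /uce_gr_D2 /= minor_degang.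
(* The bracket of [uce] depends only on images under [umap], which are known for [xroot]. *)
by rewrite -uang_degang // /lie /= /uce_lie !umap_xroot.
Qed.
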